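(* Suppose a Legendrian link $K$ in $\mathbb{R}^3$ has a decomposable exact Lagrangian filling. Then $K$ has at least one even normal ruling.
   Context: **Fronts.** $\mathbb{R}^3$ has the standard contact structure $\ker(dz-y\,dx)$. A Legendrian link is a smooth link everywhere tangent to it. Its front diagram is its projection to the $(x,z)$-plane, which has left cusps, right cusps and transverse crossings and no vertical tangents. Front diagrams are assumed generic: all cusps and crossings have distinct $x$-coordinates. **Normal rulings.** Let $\rho$ be a subset of the crossings of a front diagram $D$. Resolving a crossing means replacing it by two non-crossing horizontal strands, one above the other. Let $D'$ be the result of resolving all crossings in $\rho$. Then $\rho$ is a normal ruling of $D$ if: (1) each component of $D'$ has exactly one left cusp, one right cusp and no self-intersections; (2) at each resolved crossing the two horizontal strands belong to different components of $D'$; (3) (normality) on the vertical line through each resolved crossing, the two vertical intervals bounded by the upper and lower strands of the two components involved are either disjoint or nested (one inside the other). $D'$ is the resolution of $\rho$, and its components are called eyes. A normal ruling of $K$ is a normal ruling of a front diagram of $K$. **Clasps and parity.** An eye $E$ has an upper strand $E_u$ and a lower strand $E_l$ over its $x$-range. Two distinct eyes $E,F$ of a resolution are non-nested at $x$ if $E_u>F_u>E_l>F_l$ or $F_u>E_u>F_l>E_l$ at $x$ (so disjoint counts as nested). Let $I$ be a maximal open interval of $x$-values on which $E,F$ are non-nested; at each of its two endpoints $E$ and $F$ cross. Each such crossing is of type T (two upper strands cross), B (two lower strands cross) or M (the lower strand of one eye crosses the upper strand of the other). The interval $I$ carries one clasp unless exactly one of its two endpoint crossings is of type M (i.e. unless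 a single strand of one eye meets both strands of the other eye at the two endpoints), in which case it carries none. The number of clasps of $\rho$ is the total number of clasps over all intervals $I$ and all unordered pairs of distinct eyes of the resolution. The ruling $\rho$ is even (odd) if its number of clasps is even (odd). **Moves.** Legendrian isotopy moves: regular isotopy (planar isotopy of fronts, with no vertical tangents, preserving cusps and crossings but possibly changing the order of their $x$-coordinates) and the Legendrian Reidemeister moves, used in either direction: R1 (a strand is replaced by a zigzag with one left cusp, one right cusp and one crossing), R2 (a strand is pushed across a cusp, creating two crossings), R3 (a strand is pushed across a crossing of two other strands). A 0-handle move adds to the front a new small standard unknot front (one left cusp, one right cusp, no crossings) in a region disjoint from the rest of the diagram. A 1-handle move replaces a right cusp facing a left cusp immediately to its right (with nothing in between) by two parallel horizontal strands. **Decomposable fillings.** Each Legendrian isotopy move, 0-handle move or 1-handle move taking a front of $K_-$ to a front of $K_+$ gives an embedded exact Lagrangian cobordism from $K_-$ to $K_+$ in the symplectization $(\mathbb{R}_t\times\mathbb{R}^3,\,d(e^t(dz-y\,dx)))$. A decomposable exact Lagrangian filling of $K$ is one arising by composing the cobordisms of a finite sequence (length $\ge1$) of such moves from the empty diagram to a front diagram of $K$. Orientability is not required. Thus $K$ has a decomposable exact Lagrangian filling if and only if such a sequence exists. *)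

(* Defs.v *)
From Stdlib Require Import Relation_Operators.
From mathcomp Require Import all_boot all_order all_algebra.
From mathcomp Require Import all_classical all_reals all_analysis.

Set Implicit Arguments.
Unset Strict Implicit.
Unset Printing Implicit Defensive.

Import Order.TTheory GRing.Theory Num.Theory.
Import numFieldNormedType.Exports.

Local Open Scope card_scope.
Local Open Scope ring_scope.
Local Open Scope classical_set_scope.

(* A generic front is recorded by its singularities, listed from left to right,
   each with its kind and with the number of strands that pass below it.  Two
   generic fronts have the same record iff they are related by a planar isotopy
   that creates no vertical tangent and keeps the singularities in the same
   order. *)

Inductive kind := LeftCusp | Crossing | RightCusp.

Record event := Event { kind_of : kind; height : nat }.

Definition diagram := seq event.

(* The strands over a non-singular abscissa are numbered 0, 1, ... from bottom
   to top.  An event at height [k] consumes the strands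
   [k, ..., k + nin - 1] on its left and produces the strands
   [k, ..., k + nout - 1] on its right. *)

Definition nin (s : kind) : nat := if s is LeftCusp then 0%N else 2%N.
Definition nout (s : kind) : nat := if s is RightCusp then 0%N else 2%N.

Definition cross_event (n : nat) (e : event) : nat :=
  (n - nin (kind_of e) + nout (kind_of e))%N.

Fixpoint front_from (n : nat) (D : diagram) : bool :=
  if D is e :: D' then
    (height e + nin (kind_of e) <= n)%N && front_from (cross_event n e) D'
  else n == 0%N.

Definition front (D : diagram) : bool := front_from 0 D.

Section LegendrianLinks.

Variable R : realType.

Definition smooth (f : R -> R) : Prop :=
  forall (n : nat) (t : R), derivable (derive1n n f) t 1.

(* Each component is parametrized by the circle R/Z. *)
Record legendrian_link := LegendrianLink {
  ncomp : nat;
  lx : 'I_ncomp -> R -> R;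
  ly : 'I_ncomp -> R -> R;
  lz : 'I_ncomp -> R -> R;
  link_smooth : forall c, [/\ smooth (lx c), smooth (ly c) & smooth (lz c)];
  link_periodic : forall c t, [/\ lx c (t + 1) = lx c t,
                                  ly c (t + 1) = ly c t &
                                  lz c (t + 1) = lz c t];
  link_immersed : forall c t,
    ~ [/\ derive1 (lx c) t = 0, derive1 (ly c) t = 0 & derive1 (lz c) t = 0];
  link_embedded : forall c c' (t t' : R), 0 <= t < 1 -> 0 <= t' < 1 ->
    lx c t = lx c' t' -> ly c t = ly c' t' -> lz c t = lz c' t' ->
    c = c' /\ t = t';
  link_legendrian : forall c t, derive1 (lz c) t = ly c t * derive1 (lx c) t }.

Variable K : legendrian_link.

Definition link_point : set ('I_(ncomp K) * R) := [set p | 0 <= p.2 < 1].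

Definition px (p : 'I_(ncomp K) * R) : R := lx p.1 p.2.
Definition pz (p : 'I_(ncomp K) * R) : R := lz p.1 p.2.
Definition dpx (p : 'I_(ncomp K) * R) : R := derive1 (lx p.1) p.2.
Definition ddpx (p : 'I_(ncomp K) * R) : R := derive1n 2 (lx p.1) p.2.

Definition double_point (p q : 'I_(ncomp K) * R) : Prop :=
  [/\ p <> q, px p = px q & pz p = pz q].

(* The points of [K] over the abscissa [a] at which its front projection fails
   to be an immersion or to be injective. *)
Definition singular_over (a : R) : set ('I_(ncomp K) * R) :=
  [set p | [/\ link_point p, px p = a &
    dpx p = 0 \/ exists2 q, link_point q & double_point p q]].

Definition nb_below (p : 'I_(ncomp K) * R) (k : nat) : Prop :=
  [set r | [/\ link_point r, px r = px p & pz r < pz p]] #= `I_k.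

(* Where [dpx] vanishes, so does the derivative of [lz], hence that of [ly] does
   not, and a nondegenerate critical point of [lx] gives a semicubical cusp.
   At a double point the values of [ly], which are the slopes of the branches
   if [dpx] does not vanish, differ, so the crossing is transverse.  The
   equations on [singular_over] say that no other singularity has the same
   abscissa. *)
Definition front_event (a : R) (e : event) : Prop :=
  match kind_of e with
  | LeftCusp => exists p, [/\ singular_over a = [set p],
      dpx p = 0, 0 < ddpx p & nb_below p (height e)]
  | RightCusp => exists p, [/\ singular_over a = [set p],
      dpx p = 0, ddpx p < 0 & nb_below p (height e)]
  | Crossing => exists p q, [/\ singular_over a = [set p; q],
      double_point p q, dpx p <> 0, dpx q <> 0 & nb_below p (height e)]
  end.

(* The front projection of [K] is generic and its record is [D]. *)
Definition front_diagram_of (D : diagram) : Prop :=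
  exists xs : seq R,
    [/\ sorted <%R xs,
        (forall a, a \in xs <-> singular_over a !=set0),
        size xs = size D &
        forall i a e, onth xs i = Some a -> onth D i = Some e ->
          front_event a e].

End LegendrianLinks.

Local Notation lcusp k := (Event LeftCusp k).
Local Notation xing k := (Event Crossing k).
Local Notation rcusp k := (Event RightCusp k).

(* In [regular_swap], the event of kind [t] takes place above the strands
   involved in the event of kind [s], with [c] strands in between.  The case
   [regular_id] stands for the planar isotopies that preserve the order of the
   singularities. *)
Inductive isotopy_move : diagram -> diagram -> Prop :=
| regular_id : isotopy_move [::] [::]
| regular_swap s t k c :
    isotopy_move [:: Event s k; Event t (k + nout s + c)]
                 [:: Event t (k + nin s + c); Event s k]
| R1_above k : isotopy_move [::] [:: lcusp k.+1; xing k; rcusp k.+1]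
| R1_below k : isotopy_move [::] [:: lcusp k; xing k.+1; rcusp k]
| R2_left_above k : isotopy_move [:: lcusp k.+1] [:: lcusp k; xing k.+1; xing k]
| R2_left_below k : isotopy_move [:: lcusp k] [:: lcusp k.+1; xing k; xing k.+1]
| R2_right_above k :
    isotopy_move [:: rcusp k.+1] [:: xing k; xing k.+1; rcusp k]
| R2_right_below k :
    isotopy_move [:: rcusp k] [:: xing k.+1; xing k; rcusp k.+1]
| R3 k :
    isotopy_move [:: xing k; xing k.+1; xing k]
                 [:: xing k.+1; xing k; xing k.+1].

Inductive handle_move : diagram -> diagram -> Prop :=
| handle0 k : handle_move [::] [:: lcusp k; rcusp k]
| handle1 k : handle_move [:: rcusp k; lcusp k] [::].

Definition move (D D' : diagram) : Prop :=
  [/\ front D, front D' &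
    exists A B U V, [/\ D = A ++ U ++ B, D' = A ++ V ++ B &
      [\/ isotopy_move U V, isotopy_move V U | handle_move U V]]].

Definition has_decomposable_filling (R : realType) (K : legendrian_link R) :
    Prop :=
  exists2 D, front_diagram_of K D & clos_trans diagram move [::] D.

Section Rulings.

Variables (D : diagram) (rho : pred nat).

(* [rho] is the set of the positions in [D] of the resolved crossings. *)
Definition crossing_subset : Prop :=
  forall i, rho i -> exists k, onth D i = Some (xing k).

(* Slice [i] is the region of the plane between the events [i - 1] and [i]; the
   pair [(i, j)] is strand [j] over slice [i].  Resolving crossings does not
   change the number of strands over a slice. *)
Definition segment := (nat * nat)%type.

Definition nstrands (i : nat) : nat := foldl cross_event 0%N (take i D).

(* Segments that are consecutive on the resolution. *)
Inductive joined : segment -> segment -> Prop :=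
| joined_below i j e : onth D i = Some e -> (j < height e)%N ->
    joined (i, j) (i.+1, j)
| joined_above i j e : onth D i = Some e ->
    joined (i, (height e + nin (kind_of e) + j)%N)
           (i.+1, (height e + nout (kind_of e) + j)%N)
| joined_left_cusp i k : onth D i = Some (lcusp k) ->
    joined (i.+1, k) (i.+1, k.+1)
| joined_right_cusp i k : onth D i = Some (rcusp k) ->
    joined (i, k) (i, k.+1)
| joined_crossing_up i k : onth D i = Some (xing k) -> ~~ rho i ->
    joined (i, k) (i.+1, k.+1)
| joined_crossing_down i k : onth D i = Some (xing k) -> ~~ rho i ->
    joined (i, k.+1) (i.+1, k)
| joined_resolved_lower i k : onth D i = Some (xing k) -> rho i ->
    joined (i, k) (i.+1, k)
| joined_resolved_upper i k : onth D i = Some (xing k) -> rho i ->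
    joined (i, k.+1) (i.+1, k.+1).

Definition component : set (set segment) :=
  [set E | exists s : segment, (s.2 < nstrands s.1)%N /\
     E = [set s' | clos_refl_sym_trans segment joined s s']].

Definition left_cusp_in (E : set segment) (i : nat) : Prop :=
  exists2 k, onth D i = Some (lcusp k) & E (i.+1, k).

Definition right_cusp_in (E : set segment) (i : nat) : Prop :=
  exists2 k, onth D i = Some (rcusp k) & E (i, k).

Definition self_crossing (E : set segment) (i : nat) : Prop :=
  exists k, [/\ onth D i = Some (xing k), ~~ rho i, E (i, k) & E (i, k.+1)].

(* Over slice [i], [E] has lower strand [l], upper strand [u] and no other. *)
Definition spans (E : set segment) (i l u : nat) : Prop :=
  (l < u)%N /\ forall j, E (i, j) <-> j = l \/ j = u.

Definition disjoint_or_nested (l u l' u' : nat) : Prop :=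
  [\/ (u < l')%N, (u' < l)%N, (l < l')%N /\ (u' < u)%N |
      (l' < l)%N /\ (u < u')%N].

Definition normal_ruling : Prop :=
  [/\ crossing_subset,
      (forall E, component E ->
         [/\ exists! i, left_cusp_in E i, exists! i, right_cusp_in E i &
             ~ exists i, self_crossing E i]) &
      (forall i k, onth D i = Some (xing k) -> rho i ->
         exists E F, [/\ component E, component F, E (i, k), F (i, k.+1) &
           E <> F /\
           exists l u l' u',
             [/\ spans E i l u, spans F i l' u' &
                 disjoint_or_nested l u l' u']])].

Definition non_nested (E F : set segment) (i : nat) : Prop :=
  exists l u l' u', [/\ spans E i l u, spans F i l' u' &
    [&& l < l', l' < u & u < u']%N \/ [&& l' < l, l < u' & u' < u]%N].

Inductive crossing_type := TypeT | TypeB | TypeM.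

Definition same_pair (a b c d : nat) : Prop :=
  (a = c /\ b = d) \/ (a = d /\ b = c).

(* The strands of the unresolved crossing at position [i] are compared on the
   slice to its left. *)
Definition cross_with_type (E F : set segment) (i : nat) (t : crossing_type) :
    Prop :=
  exists k l u l' u',
    [/\ onth D i = Some (xing k), ~~ rho i, spans E i l u, spans F i l' u' &
      match t with
      | TypeT => same_pair u u' k k.+1
      | TypeB => same_pair l l' k k.+1
      | TypeM => same_pair l u' k k.+1 \/ same_pair u l' k k.+1
      end].

(* A maximal interval of non-nestedness is given by the positions [p] and [q] of
   its two endpoint crossings; it is made of the slices [p + 1, ..., q]. *)
Definition non_nested_interval (E F : set segment) (p q : nat) : Prop :=
  [/\ (p < q)%N,
      forall i, (p < i <= q)%N -> non_nested E F i,
      ~ non_nested E F p & ~ non_nested E F q.+1].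

Definition carries_clasp (E F : set segment) (p q : nat) : Prop :=
  exists s t, [/\ cross_with_type E F p s, cross_with_type E F q t &
    (s = TypeM <-> t = TypeM)].

(* A clasp is recorded by the unordered pair of its eyes and its interval. *)
Definition clasps : set (set (set segment) * (nat * nat)) :=
  [set c | exists E F, [/\ component E, component F, E <> F,
     c.1 = [set E; F] &
     non_nested_interval E F c.2.1 c.2.2 /\
     carries_clasp E F c.2.1 c.2.2]].

Definition even_ruling : Prop := exists2 n, clasps #= `I_n & ~~ odd n.

End Rulings.

Definition has_even_normal_ruling (R : realType) (K : legendrian_link R) :
    Prop :=
  exists D rho, [/\ front_diagram_of K D, normal_ruling D rho &
    even_ruling D rho].

(* Main.v *)
From Stdlib Require Import Relation_Operators.
Require Import Defs.
From mathcomp Require Import all_boot all_order all_algebra.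
From mathcomp Require Import all_classical all_reals all_analysis.
From mathcomp Require Import zify.

Set Implicit Arguments.
Unset Strict Implicit.
Unset Printing Implicit Defensive.

Local Open Scope card_scope.
Local Open Scope classical_set_scope.

(** A normal ruling can be read from left to right as a succession of fixed
    point free involutions: over each slice of the plane, every strand is
    matched with the other strand of its eye.  A cusp creates or deletes a pair
    of adjacent matched strands, an unresolved crossing conjugates the involution
    by a transposition, and a resolved crossing leaves it unchanged, provided the
    two eyes are disjoint or nested.  Everything is then local, including the
    parity of the number of clasps.

    For the parity, count each clasp by the ends of its interval.  Let [M] be 1
    at a crossing of type M and 0 at the others.  An interval with endpoint
    crossings [p] and [q] carries [1 + M(p) + M(q)] clasps modulo 2, hence the
    number of clasps is, modulo 2, the sum over all unresolved crossings of [M],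
    plus 1 at those where an interval begins.  A look at the three types of
    crossings shows that this summand has a uniform expression: if the crossing
    exchanges the strands [k] and [k + 1], which are matched on its left with [a]
    and [b], then it is 1 when [b < a] and 0 when [a < b].  So a ruling is even
    exactly when an even number of its unresolved crossings satisfy [b < a].

    Say that a diagram takes a matching to another one with a given parity if
    some choice of resolved crossings does.  Each isotopy move replaces a piece
    of diagram by one that induces the same relation between the matching on its
    left, the matching on its right and the parity ([reach_isotopy]).  A
    0-handle can be traversed without changing the matching, and so could the
    two cusps that a 1-handle move deletes.  As the empty diagram takes the empty
    matching to itself evenly, so does every diagram obtained by a filling
    ([reach_filling]).

    Conversely, a choice of resolved crossings that is compatible with the
    matchings is a normal ruling ([run_normal_ruling]): label each strand by the
    left cusp where its eye begins; the labels are constant on the components of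
    the resolution, distinguish them, and two strands over one slice have the
    same label when they are matched.  The interval count above, made for each
    pair of labels, shows that the parity of the traversal is that of the number
    of clasps ([clasps_card], [parity_clasps]). *)

Local Notation lcusp k := (Event LeftCusp k).
Local Notation xing k := (Event Crossing k).
Local Notation rcusp k := (Event RightCusp k).

(** * Moving strands and matchings across an event *)

Definition swap k j := if j == k then k.+1 else if j == k.+1 then k else j.

(** [skip k] renumbers the strands when two new ones appear at height [k];
    [unskip k] is its inverse away from those two. *)
Definition skip k j := if j < k then j else j.+2.
Definition unskip k j := if j < k then j else j.-2.

Ltac split_ifs :=
  repeat match goal with |- context[if ?b then _ else _] =>
    lazymatch b with
    | context[if _ then _ else _] => fail
    | _ => case: (boolP b) => ? /=
    end
  end.

Lemma swapK k : involutive (swap k).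
Proof. by move=> j; rewrite /swap; split_ifs; lia. Qed.

Lemma swapl k : swap k k = k.+1.
Proof. by rewrite /swap eqxx. Qed.

Lemma swapr k : swap k k.+1 = k.
Proof. by rewrite /swap eqxx; case: eqP => //; lia. Qed.

Lemma swap_id k j : j != k -> j != k.+1 -> swap k j = j.
Proof. by rewrite /swap => /negbTE -> /negbTE ->. Qed.

Lemma swap_lt k j m : k.+1 < m -> (swap k j < m) = (j < m).
Proof. by move=> km; rewrite /swap; split_ifs; lia. Qed.

Lemma swap_ltE k u v : (swap k u < swap k v) =
  (u < v) (+) ((u == k) && (v == k.+1) || (u == k.+1) && (v == k)).
Proof. by rewrite /swap; split_ifs; lia. Qed.

Lemma skipK k : cancel (skip k) (unskip k).
Proof. by move=> j; rewrite /skip /unskip; split_ifs; lia. Qed.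

Lemma unskipK k j : j != k -> j != k.+1 -> skip k (unskip k j) = j.
Proof. by move=> *; rewrite /skip /unskip; split_ifs; lia. Qed.

Lemma skip_neq k j : ((skip k j == k) = false) * ((skip k j == k.+1) = false).
Proof. by split; rewrite /skip; split_ifs; lia. Qed.

Lemma skip_lt k i j : (skip k i < skip k j) = (i < j).
Proof. by rewrite /skip; split_ifs; lia. Qed.

Lemma skip_ltn n k j : k <= n -> (skip k j < n.+2) = (j < n).
Proof. by rewrite /skip; split_ifs; lia. Qed.

Variant skip_spec k : nat -> Type :=
| SkipLower : skip_spec k k
| SkipUpper : skip_spec k k.+1
| SkipOther j : skip_spec k (skip k j).

Lemma skipP k j : skip_spec k j.
Proof.
have [->|n1] := eqVneq j k; first exact: SkipLower.
have [->|n2] := eqVneq j k.+1; first exact: SkipUpper.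
by rewrite -(unskipK n1 n2); apply: SkipOther.
Qed.

Definition matching := nat -> nat.

Definition crossed k (p : matching) : matching :=
  fun j => swap k (p (swap k j)).

Definition opened k (p : matching) : matching :=
  fun j => if (j == k) || (j == k.+1) then swap k j else skip k (p (unskip k j)).

Definition unopened k (p : matching) : matching :=
  fun j => unskip k (p (skip k j)).

(** A matching of [n] strands is extended by the identity, so that the matchings
    produced by two pieces of diagram can be compared as functions. *)
Definition matches n (p : matching) : Prop :=
  (forall j, p (p j) = j) /\ forall j, (p j != j) = (j < n).

Lemma matches_id : matches 0 id.
Proof. by split=> // j; rewrite eqxx. Qed.

Lemma matches_lt n p j : matches n p -> (p j < n) = (j < n).
Proof. by case=> h1 h2; rewrite -!h2 h1 eq_sym. Qed.

Lemma matches_neq n p j : matches n p -> j < n -> p j <> j.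
Proof. by move=> [_ h] jn e; have := h j; rewrite e eqxx jn. Qed.

Lemma matches_inj n p i j : matches n p -> p i = p j -> i = j.
Proof. by case=> h _ e; rewrite -[i]h e h. Qed.

Lemma matches_swapE n p i j : matches n p -> (p i == j) = (p j == i).
Proof. by case=> h _; apply/eqP/eqP => <-. Qed.

Lemma openedl k p : opened k p k = k.+1.
Proof. by rewrite /opened eqxx swapl. Qed.

Lemma openedr k p : opened k p k.+1 = k.
Proof. by rewrite /opened eqxx orbT swapr. Qed.

Lemma opened_skip k p j : opened k p (skip k j) = skip k (p j).
Proof. by rewrite /opened !skip_neq skipK. Qed.

Lemma matches_opened n k p :
  k <= n -> matches n p -> matches n.+2 (opened k p).
Proof.
move=> kn [h1 h2]; split=> j; case: (skipP k j) => [||i].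
- by rewrite openedl openedr.
- by rewrite openedr openedl.
- by rewrite !opened_skip h1.
- by rewrite openedl; lia.
- by rewrite openedr; lia.
- by rewrite opened_skip (can_eq (@skipK k)) h2 /skip; split_ifs; lia.
Qed.

Lemma skip_unopened n k p j : matches n p -> p k = k.+1 ->
  skip k (unopened k p j) = p (skip k j).
Proof.
move=> [h1 _] pk; have pk1 : p k.+1 = k by rewrite -pk h1.
have [/eqP n1 /eqP n2] := skip_neq k j.
by rewrite unskipK //; apply/eqP => e; [apply: n2 | apply: n1];
  rewrite -[skip k j]h1 e.
Qed.

Lemma matches_unopened n k p : k.+2 <= n -> p k = k.+1 -> matches n p ->
  matches (n - 2) (unopened k p).
Proof.
move=> kn pk mp; have [h1 h2] := mp.
have skp j := skip_unopened j mp pk.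
split=> j; first by rewrite {1}/unopened skp h1 skipK.
by rewrite -(can_eq (@skipK k)) skp h2 /skip; split_ifs; lia.
Qed.

Lemma matches_crossed n k p :
  k.+2 <= n -> matches n p -> matches n (crossed k p).
Proof.
move=> kn [h1 h2]; split=> j; first by rewrite /crossed swapK h1 swapK.
by rewrite -(can_eq (@swapK k)) /crossed swapK h2 /swap; split_ifs; lia.
Qed.

Lemma unopened_openedK k p : unopened k (opened k p) = p.
Proof. by apply/funext => j; rewrite /unopened opened_skip skipK. Qed.

Lemma opened_unopenedK n k p : matches n p -> p k = k.+1 ->
  opened k (unopened k p) = p.
Proof.
move=> mp pk; apply/funext => j; case: (skipP k j) => [||i].
- by rewrite openedl.
- by rewrite openedr -pk (proj1 mp).
- by rewrite opened_skip (skip_unopened _ mp pk).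
Qed.

Lemma crossedK k p : crossed k (crossed k p) = p.
Proof. by apply/funext => j; rewrite /crossed !swapK. Qed.

Lemma braid k p : crossed k (crossed k.+1 (crossed k p)) =
  crossed k.+1 (crossed k (crossed k.+1 p)).
Proof.
have sw j : swap k (swap k.+1 (swap k j)) = swap k.+1 (swap k (swap k.+1 j)).
  by rewrite /swap; split_ifs; lia.
by apply/funext => j; rewrite /crossed sw !sw.
Qed.

(* The next tactics decide statements about the matchings deduced from [p] by
   [opened], [unopened] and [crossed]: a condition is resolved by arithmetic when
   the context determines it and split otherwise, each value of [p] gets a name,
   and [matching_cases] adds that [p] is an involution. *)
Ltac eval_strands p :=
  repeat match goal with
  | |- context[if ?b then _ else _] =>
    lazymatch b with
    | context[if _ then _ else _] => fail
    | context[p _] => fail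
    | _ => first [ rewrite (_ : b = true); [|lia]
                 | rewrite (_ : b = false); [|lia]
                 | case: (boolP b) => ? ]
    end
  | |- context[p ?t] =>
    lazymatch t with
    | context[if _ then _ else _] => fail
    | context[p _] => fail
    | _ => first
      [ match goal with H : p ?u = ?x |- _ =>
          rewrite (_ : p t = x); [|rewrite -H; congr (p _); lia] end
      | let x := fresh "x" in let e := fresh "e" in move e : (p t) => x ]
    end
  end.

Ltac strand_cases p :=
  rewrite /opened /crossed /unopened /swap /skip /unskip;
  eval_strands p; try lia.

Ltac add_involution mp p :=
  repeat match goal with H : p ?t = ?x |- _ =>
    lazymatch goal with
    | _ : p x = t |- _ => fail
    | _ => assert (p x = t) by exact
        (Logic.eq_trans (f_equal p (Logic.eq_sym H)) (proj1 mp t))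
    end
  end.

Ltac add_congruences p :=
  repeat match goal with H : p ?t = ?x, G : p ?u = ?y |- _ =>
    lazymatch goal with
    | _ : t = u -> x = y |- _ => fail
    | _ => assert (t = u -> x = y) by exact (fun E =>
        Logic.eq_trans (Logic.eq_sym H) (Logic.eq_trans (f_equal p E) G))
    end
  end.

Ltac matching_cases mp p :=
  strand_cases p; add_involution mp p; add_congruences p; lia.

(** * Rulings as traversals of the diagram *)

(** The eyes of two adjacent strands, matched with [a] and [b], are disjoint or
    nested. *)
Definition switchable k a b :=
  [|| (a < k) && (k.+1 < b), (b < a) && (a < k) | (k.+1 < b) && (b < a)].

Definition admits (e : event) (r : bool) (p : matching) : bool :=
  let k := height e in
  match kind_of e with
  | LeftCusp => ~~ r
  | Crossing => if r then switchable k (p k) (p k.+1) else p k != k.+1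
  | RightCusp => ~~ r && (p k == k.+1)
  end.

(** The contribution of an event to the parity of the number of clasps, as
    computed in [meets_weight]. *)
Definition weight (e : event) (r : bool) (p : matching) : bool :=
  if kind_of e is Crossing then ~~ r && (p (height e).+1 < p (height e))
  else false.

Definition after (e : event) (r : bool) (p : matching) : matching :=
  match kind_of e with
  | LeftCusp => opened (height e) p
  | Crossing => if r then p else crossed (height e) p
  | RightCusp => unopened (height e) p
  end.

(** For some choice of resolved crossings, [D] takes the matching [p] to [q] and
    the weights of its events add up to [b] modulo 2. *)
Fixpoint reach (D : diagram) (p : matching) (b : bool) (q : matching) : Prop :=
  if D is e :: D' then
    exists2 r, admits e r p & reach D' (after e r p) (weight e r p (+) b) q
  else b = false /\ q = p.

Lemma reach_cat D D' p b q :
  reach (D ++ D') p b q <->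
  exists p' b', reach D p b' p' /\ reach D' p' (b' (+) b) q.
Proof.
elim: D p b => [|e D IH] p b /=.
  split=> [h|]; first by exists p, false.
  by case=> p' [b' [[-> ->]]].
split.
  case=> r a /IH[p' [b' [h1 h2]]]; exists p', (weight e r p (+) b').
  split; last by rewrite -addbA addbCA.
  by exists r => //; rewrite addbA addbb.
case=> p' [b' [[r a h1] h2]]; exists r => //; apply/IH.
by exists p', (weight e r p (+) b'); split=> //; rewrite -addbA addbCA addKb.
Qed.

Fixpoint fits (n : nat) (D : diagram) : bool :=
  if D is e :: D' then
    (height e + nin (kind_of e) <= n)%N && fits (cross_event n e) D'
  else true.

Definition width (n : nat) (D : diagram) : nat := foldl cross_event n D.

Lemma front_fromE n D : front_from n D = fits n D && (width n D == 0).
Proof. by elim: D n => //= e D IH n; rewrite IH andbA. Qed.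

Lemma fits_cat n D D' : fits n (D ++ D') = fits n D && fits (width n D) D'.
Proof. by elim: D n => //= e D IH n; rewrite IH andbA. Qed.

Lemma matches_after n e r p : height e + nin (kind_of e) <= n ->
  matches n p -> admits e r p -> matches (cross_event n e) (after e r p).
Proof.
case: e => [[] k] /= kn mp; rewrite /admits /after /cross_event /=.
- move=> _; have := @matches_opened n k p; rewrite subn0 addn2; apply=> //.
  by lia.
- have -> : n - 2 + 2 = n by lia.
  by case: r => // _; apply: matches_crossed => //; lia.
- case/andP=> _ /eqP pk; rewrite addn0; apply: matches_unopened => //.
  by lia.
Qed.

Lemma matches_reach n D p b q : fits n D -> matches n p -> reach D p b q ->
  matches (width n D) q.
Proof.
elim: D n p b => [|e D IH] n p b /=; first by move=> _ mp [_ ->].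
by case/andP=> he fD mp [r a]; apply: IH => //; apply: matches_after.
Qed.

(** * Exchanging two distant singularities *)

Section Far.
Variables (n : nat) (p : matching).
Hypothesis mp : matches n p.

Lemma skip_lower k c : skip (k + 2 + c) k = k.
Proof. by rewrite /skip; split_ifs; lia. Qed.

Lemma skip_lower1 k c : skip (k + 2 + c) k.+1 = k.+1.
Proof. by rewrite /skip; split_ifs; lia. Qed.

Lemma skip_upper k c : skip k (k + c) = k + 2 + c.
Proof. by rewrite /skip; split_ifs; lia. Qed.

Lemma skip_upper1 k c : skip k (k + c).+1 = (k + 2 + c).+1.
Proof. by rewrite /skip; split_ifs; lia. Qed.

Lemma skip_skip k c i :
  skip (k + 2 + c) (skip k i) = skip k (skip (k + c) i).
Proof. by rewrite /skip; split_ifs; lia. Qed.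

Lemma opened_opened k c :
  opened (k + 2 + c) (opened k p) = opened k (opened (k + c) p).
Proof. by apply/funext => j; strand_cases p. Qed.

Lemma crossed_opened k c :
  crossed (k + 2 + c) (opened k p) = opened k (crossed (k + c) p).
Proof. by apply/funext => j; strand_cases p. Qed.

Lemma crossed_crossed k c :
  crossed (k + 2 + c) (crossed k p) = crossed k (crossed (k + 2 + c) p).
Proof. by apply/funext => j; strand_cases p. Qed.

Lemma opened_crossed k c :
  opened (k + 2 + c) (crossed k p) = crossed k (opened (k + 2 + c) p).
Proof. by apply/funext => j; strand_cases p. Qed.

Lemma unopened_opened k c : p (k + c) = (k + c).+1 ->
  unopened (k + 2 + c) (opened k p) = opened k (unopened (k + c) p).
Proof.
move=> pk; have kn : k <= n by have := proj2 mp (k + c); rewrite pk; lia.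
have qk : opened k p (k + 2 + c) = (k + 2 + c).+1.
  by rewrite -{1}skip_upper opened_skip pk skip_upper1.
apply/funext => j; apply: (can_inj (@skipK (k + 2 + c))).
rewrite (skip_unopened _ (matches_opened kn mp) qk).
case: (skipP k j) => [||i].
- by rewrite skip_lower !openedl skip_lower1.
- by rewrite skip_lower1 !openedr skip_lower.
- by rewrite opened_skip !skip_skip opened_skip (skip_unopened _ mp pk).
Qed.

Lemma unopened_crossed k c : p (k + 2 + c) = (k + 2 + c).+1 ->
  unopened (k + 2 + c) (crossed k p) = crossed k (unopened (k + 2 + c) p).
Proof. by move=> pk; apply/funext => j; matching_cases mp p. Qed.

Lemma opened_unopened k c : p k = k.+1 ->
  opened (k + c) (unopened k p) = unopened k (opened (k + 2 + c) p).
Proof. by move=> pk; apply/funext => j; matching_cases mp p. Qed.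

Lemma crossed_unopened k c : p k = k.+1 ->
  crossed (k + c) (unopened k p) = unopened k (crossed (k + 2 + c) p).
Proof. by move=> pk; apply/funext => j; matching_cases mp p. Qed.

Lemma unopened_unopened k c : p k = k.+1 -> p (k + 2 + c) = (k + 2 + c).+1 ->
  unopened (k + c) (unopened k p) = unopened k (unopened (k + 2 + c) p).
Proof. by move=> pk pk2; apply/funext => j; strand_cases p. Qed.

Lemma after_far s t r1 r2 k c :
  admits (Event s k) r1 p -> admits (Event t (k + nin s + c)) r2 p ->
  after (Event t (k + nout s + c)) r2 (after (Event s k) r1 p) =
  after (Event s k) r1 (after (Event t (k + nin s + c)) r2 p).
Proof.
case: s; case: t; case: r1; case: r2 => //=;
  rewrite /admits /after /= ?addn0.
- by move=> _ _; apply: opened_opened.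
- by move=> _ _; apply: crossed_opened.
- by move=> _ /eqP ?; apply: unopened_opened.
- by move=> _ _; apply: opened_crossed.
- by move=> _ _; apply: crossed_crossed.
- by move=> _ /eqP ?; apply: unopened_crossed.
- by move=> /eqP ? _; apply: opened_unopened.
- by move=> /eqP ? _; apply: crossed_unopened.
- by move=> /eqP ? /eqP ?; apply: unopened_unopened.
Qed.

Definition both_crossings s t :=
  if (s, t) is (Crossing, Crossing) then true else false.

Lemma crossed_far_lower k c : (crossed (k + 2 + c) p k == k.+1) = (p k == k.+1).
Proof. by strand_cases p. Qed.

Lemma crossed_far_upper k c :
  (crossed k p (k + 2 + c) == (k + 2 + c).+1) =
  (p (k + 2 + c) == (k + 2 + c).+1).
Proof. by strand_cases p. Qed.

Lemma opened_switch_lower k c :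
  switchable k (opened (k + 2 + c) p k) (opened (k + 2 + c) p k.+1)
  = switchable k (p k) (p k.+1).
Proof. by rewrite /switchable; strand_cases p. Qed.

Lemma opened_switch_upper k c :
  switchable (k + 2 + c) (opened k p (k + 2 + c)) (opened k p (k + 2 + c).+1) =
  switchable (k + c) (p (k + c)) (p (k + c).+1).
Proof. by rewrite /switchable; strand_cases p. Qed.

Lemma opened_far_lower k c : (opened (k + 2 + c) p k == k.+1) = (p k == k.+1).
Proof. by strand_cases p. Qed.

Lemma opened_far_upper k c :
  (opened k p (k + 2 + c) == (k + 2 + c).+1) = (p (k + c) == (k + c).+1).
Proof. by strand_cases p. Qed.

Lemma switchable_skip_lower k c i j :
  switchable k (skip (k + 2 + c) i) (skip (k + 2 + c) j) = switchable k i j.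
Proof. by rewrite /switchable /skip; split_ifs; lia. Qed.

Lemma switchable_skip_upper k c i j :
  switchable (k + 2 + c) (skip k i) (skip k j) = switchable (k + c) i j.
Proof. by rewrite /switchable /skip; split_ifs; lia. Qed.

(** The crossings at heights [k] and [k + 2 + c] are then crossings of the same
    two eyes. *)
Definition linked k c :=
  (p k == k + 2 + c) && (p k.+1 == (k + 2 + c).+1)
  || (p k == (k + 2 + c).+1) && (p k.+1 == k + 2 + c).

Lemma linkedE k c : linked k c =
  (p (k + 2 + c) == k) && (p (k + 2 + c).+1 == k.+1)
  || (p (k + 2 + c) == k.+1) && (p (k + 2 + c).+1 == k).
Proof.
by rewrite /linked ![p k == _](matches_swapE _ _ mp)
  ![p k.+1 == _](matches_swapE _ _ mp) [X in _ || X]andbC.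
Qed.

Lemma linkedP k c : linked k c ->
  [/\ p k = k + 2 + c, p k.+1 = (k + 2 + c).+1,
      p (k + 2 + c) = k & p (k + 2 + c).+1 = k.+1] \/
  [/\ p k = (k + 2 + c).+1, p k.+1 = k + 2 + c,
      p (k + 2 + c) = k.+1 & p (k + 2 + c).+1 = k].
Proof.
have [pK _] := mp; rewrite /linked.
by case/orP => /andP[/eqP e1 /eqP e2]; [left | right];
  have := pK k; have := pK k.+1; rewrite e1 e2.
Qed.

Lemma crossed_switch_lower k c : ~~ linked k c ->
  switchable k (crossed (k + 2 + c) p k) (crossed (k + 2 + c) p k.+1)
  = switchable k (p k) (p k.+1).
Proof. by rewrite /linked /switchable => h; strand_cases p. Qed.

Lemma crossed_switch_upper k c : ~~ linked k c ->
  switchable (k + 2 + c) (crossed k p (k + 2 + c)) (crossed k p (k + 2 + c).+1)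
  = switchable (k + 2 + c) (p (k + 2 + c)) (p (k + 2 + c).+1).
Proof. by rewrite linkedE /switchable => h; strand_cases p. Qed.

Lemma crossed_weight k c :
  (p k.+1 < p k) (+) (crossed k p (k + 2 + c).+1 < crossed k p (k + 2 + c)) =
  (p (k + 2 + c).+1 < p (k + 2 + c))
  (+) (crossed (k + 2 + c) p k.+1 < crossed (k + 2 + c) p k).
Proof.
have [|nl] := boolP (linked k c).
  by case/linkedP => -[e1 e2 e3 e4]; strand_cases p.
have -> : (crossed k p (k + 2 + c).+1 < crossed k p (k + 2 + c)) =
    (p (k + 2 + c).+1 < p (k + 2 + c)).
  by move: nl; rewrite linkedE => h; strand_cases p.
rewrite addbC; congr (_ (+) _); move: nl; rewrite /linked => h.
by strand_cases p.
Qed.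

(** If the two crossings involve the same two eyes, traversing either of them
    toggles between nested and non-nested, and gives the same matching. *)
Lemma crossed_linked k c : linked k c -> crossed k p = crossed (k + 2 + c) p.
Proof.
move/linkedP => l; apply/funext => j.
have [jk|jk] := boolP (j \in [:: k; k.+1; k + 2 + c; (k + 2 + c).+1]).
  move: jk; rewrite !inE; case: l => -[e1 e2 e3 e4];
    case/or4P => /eqP ->; strand_cases p.
have jp : p j \notin [:: k; k.+1; k + 2 + c; (k + 2 + c).+1].
  move: jk; rewrite !inE ![p j == _](matches_swapE _ _ mp).
  by case: l => -[-> -> -> ->]; lia.
move: jk jp; rewrite !inE => jk jp.
by rewrite /crossed ![swap _ j]swap_id ?[swap _ (p j)]swap_id //; lia.
Qed.

Lemma admits_far s t r1 r2 k c :
  ~~ [&& both_crossings s t, r1 != r2 & linked k c] ->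
  admits (Event s k) r1 p &&
    admits (Event t (k + nout s + c)) r2 (after (Event s k) r1 p)
  = admits (Event t (k + nin s + c)) r2 p &&
    admits (Event s k) r1 (after (Event t (k + nin s + c)) r2 p).
Proof.
case: s; case: t; case: r1; case: r2 => //=;
  rewrite /admits /after /= ?addn0 => h; rewrite ?andbT ?andbF //.
- exact: opened_switch_upper.
- by rewrite opened_far_upper.
- by rewrite opened_far_upper.
- by rewrite opened_switch_lower.
- by rewrite opened_far_lower.
- by rewrite andbC.
- by rewrite crossed_switch_lower // andbC.
- by rewrite crossed_switch_upper // andbC.
- by rewrite crossed_far_upper crossed_far_lower andbC.
- rewrite andbC; case: eqP => //= pk; have su := skip_unopened _ mp pk.
  by rewrite -(switchable_skip_lower k c (unopened _ _ _)) !su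
    skip_lower skip_lower1.
- rewrite crossed_far_upper andbC; case: eqP => //= pk.
  by rewrite -(can_eq (@skipK (k + 2 + c)) (unopened _ _ _))
    (skip_unopened _ mp pk) skip_lower skip_lower1.
- by rewrite opened_far_lower.
- case: eqP => //= pk; rewrite ?andbF // andbT.
  by rewrite -(switchable_skip_upper k c (unopened _ _ _))
    !(skip_unopened _ mp pk) skip_upper skip_upper1.
- rewrite crossed_far_lower andbC.
  have [pk|_] := eqVneq (p k) k.+1; rewrite ?andbF // ?andbT.
  by rewrite -(can_eq (@skipK k) (unopened _ _ _)) (skip_unopened _ mp pk)
    skip_upper skip_upper1 ?andbT.
- have low (pk2 : p (k + 2 + c) = (k + 2 + c).+1) :
      (unopened (k + 2 + c) p k == k.+1) = (p k == k.+1).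
    by rewrite -(can_eq (@skipK (k + 2 + c)) (unopened _ _ _))
      (skip_unopened _ mp pk2) skip_lower skip_lower1.
  have upp (pk : p k = k.+1) : (unopened k p (k + c) == (k + c).+1) =
      (p (k + 2 + c) == (k + 2 + c).+1).
    by rewrite -(can_eq (@skipK k) (unopened _ _ _))
      (skip_unopened _ mp pk) skip_upper skip_upper1.
  have [pk|npk] /= := eqVneq (p k) k.+1.
    by rewrite upp //; have [pk2|] //= := eqVneq; rewrite low // pk eqxx.
  by have [pk2|] //= := eqVneq; rewrite low // (negbTE npk).
Qed.

Lemma weight_far s t r1 r2 k c :
  admits (Event s k) r1 p -> admits (Event t (k + nin s + c)) r2 p ->
  weight (Event s k) r1 p
    (+) weight (Event t (k + nout s + c)) r2 (after (Event s k) r1 p)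
  = weight (Event t (k + nin s + c)) r2 p
    (+) weight (Event s k) r1 (after (Event t (k + nin s + c)) r2 p).
Proof.
case: s; case: t; case: r1; case: r2 => //=;
  rewrite /admits /weight /after /= ?addn0 => a1 a2; rewrite ?addbF //.
- by rewrite -skip_upper1 -skip_upper !opened_skip skip_lt.
- have e i : skip (k + 2 + c) i = i ->
      opened (k + 2 + c) p i = skip (k + 2 + c) (p i).
    by move=> ei; rewrite -{1}ei opened_skip.
  by rewrite (e _ (skip_lower k c)) (e _ (skip_lower1 k c)) skip_lt.
- exact: crossed_weight.
- rewrite -[RHS](skip_lt (k + 2 + c)) !(skip_unopened _ mp (eqP a2)).
  by rewrite skip_lower skip_lower1.
- rewrite -[LHS](skip_lt k) !(skip_unopened _ mp (eqP a1)).
  by rewrite skip_upper skip_upper1.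
Qed.

(** When exactly one of two linked crossings is resolved, it must be the second
    one to be traversed if the eyes start non-nested and the first one if they
    start nested: the choice of flags goes with the order of traversal and not
    with the crossings. *)
Lemma linked_flags k c r1 r2 : linked k c -> r1 != r2 ->
  let s := xing k in let t := xing (k + 2 + c) in
  admits s r1 p && admits t r2 (after s r1 p)
  = admits t r1 p && admits s r2 (after t r1 p)
  /\ weight s r1 p (+) weight t r2 (after s r1 p)
  = weight t r1 p (+) weight s r2 (after t r1 p).
Proof.
case/linkedP => -[e1 e2 e3 e4]; case: r1; case: r2 => // _;
  rewrite /admits /weight /after /switchable /=; split; strand_cases p.
Qed.

Lemma reach_swap s t k c b q :
  reach [:: Event s k; Event t (k + nout s + c)] p b q <->
  reach [:: Event t (k + nin s + c); Event s k] p b q.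
Proof.
split=> /= -[r1 a1 [r2 a2 [+ ->]]]; rewrite addbA [X in X (+) b]addbC => w0.
- have [/and3P[]|l] := boolP [&& both_crossings s t, r1 != r2 & linked k c].
    case: s t a1 a2 w0 => -[] //= a1 a2 w0 _ ne l.
    have [] := linked_flags l ne.
    rewrite a1 a2 => /esym/andP[a1' a2'] w1.
    exists r1 => //; exists r2 => //; split.
      by rewrite addbA [X in X (+) b]addbC -w1.
    by move: ne {a1 a2 a1' a2' w0 w1}; case: r1; case: r2 => //= _;
      rewrite /after /= (crossed_linked l).
  have := admits_far l; rewrite a1 a2 => /esym/andP[a3 a4].
  exists r2 => //; exists r1 => //; split; last exact: after_far.
  by rewrite addbA [X in X (+) b]addbC -weight_far.
- have [/and3P[]|l] := boolP [&& both_crossings s t, r2 != r1 & linked k c].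
    case: s t a1 a2 w0 => -[] //= a1 a2 w0 _ ne l; rewrite eq_sym in ne.
    have [] := linked_flags l ne.
    rewrite a1 a2 => /andP[a1' a2'] w1.
    exists r1 => //; exists r2 => //; split.
      by rewrite addbA [X in X (+) b]addbC w1.
    by move: ne {a1 a2 a1' a2' w0 w1}; case: r1; case: r2 => //= _;
      rewrite /after /= (crossed_linked l).
  have := admits_far l; rewrite a1 a2 => /andP[a3 a4].
  exists r2 => //; exists r1 => //; split; last by rewrite after_far.
  by rewrite addbA [X in X (+) b]addbC weight_far.
Qed.

End Far.

(** * Reidemeister moves *)

Section Reidemeister.
Variables (n : nat) (p : matching).
Hypothesis mp : matches n p.

Lemma reach_R1_above k b q : k < n ->
  reach [::] p b q <-> reach [:: lcusp k.+1; xing k; rcusp k.+1] p b q.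
Proof.
move=> kn; have pk := matches_neq mp kn.
have [a e0] : exists a, p k = a by exists (p k).
split.
  case=> -> ->; exists false => //; exists true.
    by rewrite /admits /switchable /after /=; strand_cases p.
  exists false; first by rewrite /admits /after /= openedl eqxx.
  by split=> //; rewrite /after /= unopened_openedK.
case=> -[] // _ [[] a2 [[] // a3 [+ ->]]]; last first.
  by exfalso; move: a2 a3; rewrite /admits /after /=; strand_cases p.
by case: b => // _; rewrite /after /= unopened_openedK.
Qed.

Lemma reach_R1_below k b q : k < n ->
  reach [::] p b q <-> reach [:: lcusp k; xing k.+1; rcusp k] p b q.
Proof.
move=> kn; have pk := matches_neq mp kn.
have [a e0] : exists a, p k = a by exists (p k).
split.
  case=> -> ->; exists false => //; exists true.
    by rewrite /admits /switchable /after /=; strand_cases p.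
  exists false; first by rewrite /admits /after /= openedl eqxx.
  by split=> //; rewrite /after /= unopened_openedK.
case=> -[] // _ [[] a2 [[] // a3 [+ ->]]]; last first.
  by exfalso; move: a2 a3; rewrite /admits /after /=; strand_cases p.
by case: b => // _; rewrite /after /= unopened_openedK.
Qed.

Lemma crossed_opened_above k :
  crossed k (crossed k.+1 (opened k p)) = opened k.+1 p.
Proof. by apply/funext => j; strand_cases p. Qed.

Lemma crossed_opened_below k :
  crossed k.+1 (crossed k (opened k.+1 p)) = opened k p.
Proof. by apply/funext => j; strand_cases p. Qed.

Lemma reach_R2_left_above k b q : k < n ->
  reach [:: lcusp k.+1] p b q <-> reach [:: lcusp k; xing k.+1; xing k] p b q.
Proof.
move=> kn; have pk := matches_neq mp kn.
have [a e0] : exists a, p k = a by exists (p k).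
split.
  case=> -[] // _ [w ->]; exists false => //; exists false.
    by rewrite /admits /after /=; strand_cases p.
  exists false; first by rewrite /admits /after /=; strand_cases p.
  split; last by rewrite /after /= crossed_opened_above.
  by case: b w => //; rewrite /weight /after /= => _; strand_cases p.
case=> -[] // _ [[] a2 [[] a3 [w ->]]].
all: try by exfalso; move: a2 a3;
  rewrite /admits /switchable /after /=; strand_cases p.
exists false => //; split; last by rewrite /after /= crossed_opened_above.
by case: b w => //; rewrite /weight /after /=; strand_cases p.
Qed.

Lemma reach_R2_left_below k b q : k < n ->
  reach [:: lcusp k] p b q <-> reach [:: lcusp k.+1; xing k; xing k.+1] p b q.
Proof.
move=> kn; have pk := matches_neq mp kn.
have [a e0] : exists a, p k = a by exists (p k).
split.
  case=> -[] // _ [w ->]; exists false => //; exists false.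
    by rewrite /admits /after /=; strand_cases p.
  exists false; first by rewrite /admits /after /=; strand_cases p.
  split; last by rewrite /after /= crossed_opened_below.
  by case: b w => //; rewrite /weight /after /= => _; strand_cases p.
case=> -[] // _ [[] a2 [[] a3 [w ->]]].
all: try by exfalso; move: a2 a3;
  rewrite /admits /switchable /after /=; strand_cases p.
exists false => //; split; last by rewrite /after /= crossed_opened_below.
by case: b w => //; rewrite /weight /after /=; strand_cases p.
Qed.

Lemma unopened_crossed_above k : p k.+1 = k.+2 ->
  unopened k (crossed k.+1 (crossed k p)) = unopened k.+1 p.
Proof. by move=> pk; apply/funext => j; matching_cases mp p. Qed.

Lemma unopened_crossed_below k : p k = k.+1 ->
  unopened k.+1 (crossed k (crossed k.+1 p)) = unopened k p.
Proof. by move=> pk; apply/funext => j; matching_cases mp p. Qed.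

Definition outside k i := (i < k) || (k.+2 < i).

(** At most two of three adjacent strands belong to the same eye. *)
Lemma strand_triple k : k.+2 < n ->
  [\/ [/\ outside k (p k), outside k (p k.+1), outside k (p k.+2) &
          [/\ p k <> p k.+1, p k <> p k.+2 & p k.+1 <> p k.+2]],
      [/\ p k = k.+1, p k.+1 = k & outside k (p k.+2)],
      [/\ p k = k.+2, p k.+2 = k & outside k (p k.+1)] |
      [/\ p k.+1 = k.+2, p k.+2 = k.+1 & outside k (p k)]].
Proof.
move=> kn; have n0 := @matches_neq _ _ k mp; have n1 := @matches_neq _ _ k.+1 mp.
have n2 := @matches_neq _ _ k.+2 mp.
have i01 : p k <> p k.+1 by move/(matches_inj mp); lia.
have i02 : p k <> p k.+2 by move/(matches_inj mp); lia.
have i12 : p k.+1 <> p k.+2 by move/(matches_inj mp); lia.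
have s01 := matches_swapE k k.+1 mp; have s02 := matches_swapE k k.+2 mp.
have s12 := matches_swapE k.+1 k.+2 mp.
rewrite /outside.
have [e|xy] := eqVneq (p k) k.+1; first by apply: Or42; split; lia.
have [e|xz] := eqVneq (p k) k.+2; first by apply: Or43; split; lia.
have [e|yz] := eqVneq (p k.+1) k.+2; first by apply: Or44; split; lia.
by apply: Or41; split; try split; lia.
Qed.

Lemma matched_above k : k.+2 < n -> p k.+1 = k.+2 ->
  p k.+2 = k.+1 /\ outside k (p k).
Proof.
by move=> kn pk; case: (strand_triple kn) => -[]; rewrite ?pk /outside; lia.
Qed.

Lemma matched_below k : k.+2 < n -> p k = k.+1 ->
  p k.+1 = k /\ outside k (p k.+2).
Proof.
by move=> kn pk; case: (strand_triple kn) => -[]; rewrite ?pk /outside; lia.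
Qed.

Lemma swap_outside k i : outside k i -> (swap k i = i) * (swap k.+1 i = i).
Proof. by rewrite /outside => h; rewrite !swap_id //; lia. Qed.

Lemma swap_above k : swap k k.+2 = k.+2.
Proof. by rewrite swap_id; lia. Qed.

Lemma swap_below k : swap k.+1 k = k.
Proof. by rewrite swap_id; lia. Qed.

Lemma crossed_lower k (p0 : matching) : crossed k p0 k = swap k (p0 k.+1).
Proof. by rewrite /crossed swapl. Qed.

Lemma crossed_upper k (p0 : matching) : crossed k p0 k.+1 = swap k (p0 k).
Proof. by rewrite /crossed swapr. Qed.

Lemma crossed_above k (p0 : matching) : crossed k p0 k.+2 = swap k (p0 k.+2).
Proof. by rewrite /crossed swap_above. Qed.

Lemma crossed_below k (p0 : matching) : crossed k.+1 p0 k = swap k.+1 (p0 k).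
Proof. by rewrite /crossed swap_below. Qed.

Definition crossedE := (swap_above, swap_below, swapl, swapr, crossedK,
  crossed_lower, crossed_upper, crossed_above, crossed_below).

Lemma reach_R2_right_above k b q : k.+2 < n ->
  reach [:: rcusp k.+1] p b q <-> reach [:: xing k; xing k.+1; rcusp k] p b q.
Proof.
move=> kn; split.
  case=> -[] //; rewrite {1}/admits /= => /eqP pk [w ->].
  have [e2 oa] := matched_above kn pk.
  have simp := (crossedE, pk, e2, swap_outside oa).
  move: oa; rewrite /outside => oa.
  do 3 (exists false; first by rewrite /admits /after /= ?simp; lia).
  split; last by rewrite /after /= unopened_crossed_above.
  by move: w; rewrite /weight /after /= ?simp; lia.
case=> r1 a1 [r2 a2 [[] // a3 [w ->]]].
have [pk nr1 nr2] : [/\ p k.+1 = k.+2, r1 = false & r2 = false].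
  move: a1 a2 a3; rewrite /admits /switchable /after /=.
  case: (strand_triple kn) =>
    [[oa ob oc _]|[e0 e1 oc]|[e0 e2 ob]|[e1 e2 oa]].
  - have simp := (crossedE, swap_outside oa, swap_outside ob, swap_outside oc).
    move: oa ob oc; rewrite /outside => oa ob oc.
    by case: r1 w; case: r2 => _; rewrite ?simp; lia.
  - have simp := (crossedE, e0, e1, swap_outside oc).
    move: oc; rewrite /outside => oc.
    by case: r1 w; case: r2 => _; rewrite ?simp; lia.
  - have simp := (crossedE, e0, e2, swap_outside ob).
    move: ob; rewrite /outside => ob.
    by case: r1 w; case: r2 => _; rewrite ?simp; lia.
  - have simp := (crossedE, e1, e2, swap_outside oa).
    move: oa; rewrite /outside => oa.
    by case: r1 w; case: r2 => _; rewrite ?simp; split=> //; lia.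
have [e2 oa] := matched_above kn pk.
have simp := (crossedE, pk, e2, swap_outside oa).
rewrite nr1 nr2 in w *.
exists false; first by rewrite /admits /= pk.
split; last by rewrite /after /= unopened_crossed_above.
by move: oa w; rewrite /outside /weight /after /= ?simp; lia.
Qed.

Lemma reach_R2_right_below k b q : k.+2 < n ->
  reach [:: rcusp k] p b q <-> reach [:: xing k.+1; xing k; rcusp k.+1] p b q.
Proof.
move=> kn; split.
  case=> -[] //; rewrite {1}/admits /= => /eqP pk [w ->].
  have [e1 oc] := matched_below kn pk.
  have simp := (crossedE, pk, e1, swap_outside oc).
  move: oc; rewrite /outside => oc.
  do 3 (exists false; first by rewrite /admits /after /= ?simp; lia).
  split; last by rewrite /after /= unopened_crossed_below.
  by move: w; rewrite /weight /after /= ?simp; lia.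
case=> r1 a1 [r2 a2 [[] // a3 [w ->]]].
have [pk nr1 nr2] : [/\ p k = k.+1, r1 = false & r2 = false].
  move: a1 a2 a3; rewrite /admits /switchable /after /=.
  case: (strand_triple kn) =>
    [[oa ob oc _]|[e0 e1 oc]|[e0 e2 ob]|[e1 e2 oa]].
  - have simp := (crossedE, swap_outside oa, swap_outside ob, swap_outside oc).
    move: oa ob oc; rewrite /outside => oa ob oc.
    by case: r1 w; case: r2 => _; rewrite ?simp; lia.
  - have simp := (crossedE, e0, e1, swap_outside oc).
    move: oc; rewrite /outside => oc.
    by case: r1 w; case: r2 => _; rewrite ?simp; split=> //; lia.
  - have simp := (crossedE, e0, e2, swap_outside ob).
    move: ob; rewrite /outside => ob.
    by case: r1 w; case: r2 => _; rewrite ?simp; lia.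
  - have simp := (crossedE, e1, e2, swap_outside oa).
    move: oa; rewrite /outside => oa.
    by case: r1 w; case: r2 => _; rewrite ?simp; lia.
have [e1 oc] := matched_below kn pk.
have simp := (crossedE, pk, e1, swap_outside oc).
rewrite nr1 nr2 in w *.
exists false; first by rewrite /admits /= pk.
split; last by rewrite /after /= unopened_crossed_below.
by move: oc w; rewrite /outside /weight /after /= ?simp; lia.
Qed.

Ltac traverse simp r1 r2 r3 :=
  exists r1; [ rewrite ?simp; lia
  | exists r2; [ rewrite ?simp; lia
  | exists r3; [ rewrite ?simp; lia
  | split; [ rewrite ?simp; lia | rewrite ?simp ?braid; reflexivity ]]]].

(** A triple of crossings with two strands of the same eye cannot be traversed,
    since these two strands would have to meet.  Otherwise the flags are reversed
    by the move when at most one crossing is resolved, because each pair of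
    strands still meets once, in the opposite order.  When two crossings are
    resolved, the third one must keep its height: for the flags [0 1 1] and
    [1 1 0] a single crossing has the same height on the other side, and for
    [1 0 1] there are two, of which normality selects one according to the
    position of two of the eyes. *)
Lemma reach_R3 k b q : k.+2 < n ->
  reach [:: xing k; xing k.+1; xing k] p b q <->
  reach [:: xing k.+1; xing k; xing k.+1] p b q.
Proof.
move=> kn; rewrite /= /admits /weight /after /switchable /=.
split=> -[r1 a1 [r2 a2 [r3 a3 [w ->]]]].
- case: (strand_triple kn) =>
    [[oa ob oc [i01 i02 i12]]|[e0 e1 oc]|[e0 e2 ob]|[e1 e2 oa]]; last first.
  + exfalso; have simp := (crossedE, e1, e2, swap_outside oa).
    move: oa a1 a2 a3 {w}; rewrite /outside => oa.
    by case: r1; case: r2; case: r3; rewrite ?simp; lia.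
  + exfalso; have simp := (crossedE, e0, e2, swap_outside ob).
    move: ob a1 a2 a3 {w}; rewrite /outside => ob.
    by case: r1; case: r2; case: r3; rewrite ?simp; lia.
  + exfalso; have simp := (crossedE, e0, e1, swap_outside oc).
    move: oc a1 a2 a3 {w}; rewrite /outside => oc.
    by case: r1; case: r2; case: r3; rewrite ?simp; lia.
  have simp := (crossedE, swap_outside oa, swap_outside ob, swap_outside oc).
  move: oa ob oc; rewrite /outside => oa ob oc.
  move: a1 a2 a3 w; case: r1; case: r2; case: r3; rewrite ?simp => a1 a2 a3 w.
  + by traverse simp true true true.
  + by traverse simp true false true.
  + have [m|m] := boolP (switchable k.+1 (p k.+1) (p k.+2));
      rewrite /switchable in m.
      by traverse simp true true false.
    by traverse simp false true true.
  + by traverse simp false false true.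
  + by traverse simp true false true.
  + by traverse simp false true false.
  + by traverse simp true false false.
  + by traverse simp false false false.
- case: (strand_triple kn) =>
    [[oa ob oc [i01 i02 i12]]|[e0 e1 oc]|[e0 e2 ob]|[e1 e2 oa]]; last first.
  + exfalso; have simp := (crossedE, e1, e2, swap_outside oa).
    move: oa a1 a2 a3 {w}; rewrite /outside => oa.
    by case: r1; case: r2; case: r3; rewrite ?simp; lia.
  + exfalso; have simp := (crossedE, e0, e2, swap_outside ob).
    move: ob a1 a2 a3 {w}; rewrite /outside => ob.
    by case: r1; case: r2; case: r3; rewrite ?simp; lia.
  + exfalso; have simp := (crossedE, e0, e1, swap_outside oc).
    move: oc a1 a2 a3 {w}; rewrite /outside => oc.
    by case: r1; case: r2; case: r3; rewrite ?simp; lia.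
  have simp := (crossedE, swap_outside oa, swap_outside ob, swap_outside oc).
  move: oa ob oc; rewrite /outside => oa ob oc.
  move: a1 a2 a3 w; case: r1; case: r2; case: r3; rewrite ?simp => a1 a2 a3 w.
  + by traverse simp true true true.
  + by traverse simp true false true.
  + have [m|m] := boolP (switchable k (p k) (p k.+1)); rewrite /switchable in m.
      by traverse simp true true false.
    by traverse simp false true true.
  + by traverse simp false false true.
  + by traverse simp true false true.
  + by traverse simp false true false.
  + by traverse simp true false false.
  + by traverse simp false false false.
Qed.

End Reidemeister.

(** * Moves and fillings *)

Lemma reach_isotopy U V n p b q : isotopy_move U V -> matches n p ->
  fits n U -> fits n V -> reach U p b q <-> reach V p b q.
Proof.
case=> [|s t k c|k|k|k|k|k|k|k] mp //= fU fV.
- exact: (reach_swap mp).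
- by apply: (reach_R1_above mp); lia.
- by apply: (reach_R1_below mp); move: fV; rewrite /cross_event /=; lia.
- by apply: (reach_R2_left_above mp); lia.
- by apply: (reach_R2_left_below mp); lia.
- by apply: (reach_R2_right_above mp); move: fV; rewrite /cross_event /=; lia.
- by apply: (reach_R2_right_below mp); move: fV; rewrite /cross_event /=; lia.
- by apply: (reach_R3 mp); move: fV; rewrite /cross_event /=; lia.
Qed.

Lemma reach_handle U V n p b q : handle_move U V -> matches n p ->
  reach U p b q -> reach V p b q.
Proof.
case=> k mp /=.
  case=> -> ->; exists false => //; exists false.
    by rewrite /admits /after /= openedl eqxx.
  by rewrite /after /= unopened_openedK.
case=> -[] // a [[] // _ [+ ->]]; case: b => // _; split=> //.
by rewrite /after /= (opened_unopenedK mp) //; apply/eqP.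
Qed.

Lemma reach_move D D' q :
  move D D' -> reach D id false q -> reach D' id false q.
Proof.
move=> [+ + [A [B [U [V [eD eD' +]]]]]].
rewrite {}eD {}eD' /front !front_fromE !fits_cat.
move=> /andP[/and3P[fA fU _] _] /andP[/and3P[_ fV _] _] h.
have UV p b q' : matches (width 0 A) p -> reach U p b q' -> reach V p b q'.
  move=> mp; case: h => [h|h|h].
  - by move/(reach_isotopy b q' h mp fU fV).
  - by move/(reach_isotopy b q' h mp fV fU).
  - exact: (reach_handle h mp).
rewrite !reach_cat => -[p [b [rA]]]; rewrite reach_cat => -[p' [b' [rU rB]]].
exists p, b; split=> //; rewrite reach_cat; exists p', b'; split=> //.
by apply: UV rU; apply: matches_reach rA => //; apply: matches_id.
Qed.

Lemma reach_filling D :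
  clos_trans diagram move [::] D -> reach D id false id.
Proof.
have gen E E' : clos_trans diagram move E E' ->
    reach E id false id -> reach E' id false id.
  by elim=> [x y /reach_move|x y z _ xy _ yz /xy/yz]; first exact.
by move/gen; apply.
Qed.

(** * The resolved crossings of a traversal *)

Fixpoint state (D : diagram) (rho : pred nat) (p : matching) (i : nat) :
    matching :=
  match i, D with
  | i'.+1, e :: D' => state D' (rho \o succn) (after e (rho 0) p) i'
  | _, _ => p
  end.

Lemma stateS D rho p i e : onth D i = Some e ->
  state D rho p i.+1 = after e (rho i) (state D rho p i).
Proof.
elim: D rho p i => [|e' D IH] rho p [|i] //=.
  by case=> ->; case: D {IH}.
by move=> /(IH (rho \o succn) (after e' (rho 0) p)).
Qed.

Definition valid_run D rho p := forall i e, onth D i = Some e ->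
  admits e (rho i) (state D rho p i).

Definition run_weight D rho p i :=
  if onth D i is Some e then weight e (rho i) (state D rho p i) else false.

Lemma admits_crossing e p : admits e true p -> exists k, e = xing k.
Proof. by case: e => -[] k //= _; exists k. Qed.

Lemma reach_run D p b q : reach D p b q -> exists rho : pred nat,
  [/\ forall i, rho i -> exists k, onth D i = Some (xing k),
      valid_run D rho p &
      \big[addb/false]_(i < size D) run_weight D rho p i = b].
Proof.
elim: D p b => [|e D IH] p b /=.
  case=> -> _; exists pred0; split=> //; last by rewrite big_ord0.
  by case.
case=> r a /IH[rho [sub adm wt]].
exists (fun i => if i is i'.+1 then rho i' else r).
split.
- case=> [|i] /=; last exact: sub.
  by move=> hr; move: a; rewrite hr => /admits_crossing[k ->]; exists k.
- by case=> [|i] e' /=; [case=> <-; case: (D) | apply: adm].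
- rewrite big_ord_recl /= {1}/run_weight /=.
  rewrite -[RHS](addKb (weight e r p)); congr (_ (+) _).
  by rewrite -wt; apply: eq_bigr => i _; rewrite /run_weight.
Qed.

(** * Parity of a sum over maximal runs *)

Lemma big_addb_unique (T : finType) (f : T -> bool) (t0 : T) :
  (forall t, f t -> t = t0) -> \big[addb/false]_t f t = f t0.
Proof.
move=> h; rewrite (bigD1 t0) //= big1 ?addbF // => t tn.
by apply/negbTE/negP => /h e; rewrite e eqxx in tn.
Qed.

Lemma odd_card (T : finType) (A : pred T) : odd #|A| = \big[addb/false]_t A t.
Proof.
rewrite -sum1_card (big_morph odd oddD (erefl : odd 0 = false)) big_mkcond /=.
by apply: eq_bigr => t _; rewrite unfold_in; case: (A t).
Qed.

Definition maximal_run (N : nat -> bool) (p q : nat) : Prop :=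
  [/\ p < q, forall i, p < i <= q -> N i, ~ N p & ~ N q.+1].

Lemma maximal_run_start N p q : maximal_run N p q -> ~~ N p && N p.+1.
Proof. by case=> pq all /negP -> _; apply: all; lia. Qed.

Lemma maximal_run_end N p q : maximal_run N p q -> N q && ~~ N q.+1.
Proof. by case=> pq all _ /negP ->; rewrite andbT; apply: all; lia. Qed.

Lemma maximal_run_uniqr N p q q' :
  maximal_run N p q -> maximal_run N p q' -> q = q'.
Proof.
move=> [pq all _ nq] [pq' all' _ nq']; case: (ltngtP q q') => // h.
  by case: nq; apply: all'; lia.
by case: nq'; apply: all; lia.
Qed.

Lemma maximal_run_uniql N p p' q :
  maximal_run N p q -> maximal_run N p' q -> p = p'.
Proof.
move=> [pq all np _] [pq' all' np' _]; case: (ltngtP p p') => // h.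
  by case: np'; apply: all; lia.
by case: np; apply: all'; lia.
Qed.

Lemma maximal_run_exr N p m : p < m -> ~~ N m -> ~~ N p -> N p.+1 ->
  exists2 q, q < m & maximal_run N p q.
Proof.
move=> pm nm np np1.
have ex : exists q, (p < q) && ~~ N q.+1.
  exists m.-1; have m1 : m.-1.+1 = m by lia.
  rewrite m1 nm andbT; have [//|h] := ltnP p m.-1.
  have e : p.+1 = m by lia.
  by rewrite e in np1; rewrite np1 in nm.
case: (ex_minnP ex) => q /andP[pq nq] mini.
have qm : q < m.
  have m1 : m.-1.+1 = m by lia.
  suff : q <= m.-1 by lia.
  apply: mini; rewrite m1 nm andbT; have [//|h] := ltnP p m.-1.
  have e : p.+1 = m by lia.
  by rewrite e in np1; rewrite np1 in nm.
exists q => //; split=> //; [|exact/negP|exact/negP].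
move=> i /andP[pi iq]; have [->//|ip] := eqVneq i p.+1.
have i1 : i.-1.+1 = i by lia.
apply/negPn/negP => ni; have : q <= i.-1; last by lia.
by apply: mini; rewrite i1 ni andbT; lia.
Qed.

Lemma maximal_run_exl N q : ~~ N 0 -> N q -> ~~ N q.+1 ->
  exists2 p, p < q & maximal_run N p q.
Proof.
move=> n0 nq nq1.
have ex : exists p, (p < q) && ~~ N p.
  by exists 0; rewrite n0 andbT; case: (q) nq; rewrite ?(negbTE n0).
have bnd p : (p < q) && ~~ N p -> p <= q by lia.
case: (ex_maxnP ex bnd) => p /andP[pq np] maxi.
exists p => //; split=> //; [|exact/negP|exact/negP].
move=> i /andP[pi]; rewrite leq_eqVlt => /orP[/eqP -> //|iq].
by apply/negPn/negP => ni; have := maxi i; rewrite iq ni => /(_ isT); lia.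
Qed.

(** Each start of a run has one end and conversely, so that a sum over the runs
    of a term for the start and a term for the end can be made locally. *)
Lemma parity_runs m N (f g : nat -> bool) : ~~ N 0 -> ~~ N m ->
  \big[addb/false]_(t : 'I_m * 'I_m)
     (`[< maximal_run N t.1 t.2 >] && (f t.1 (+) g t.2)) =
  \big[addb/false]_(i < m)
     ((~~ N i && N i.+1 && f i) (+) (N i && ~~ N i.+1 && g i)).
Proof.
move=> n0 nm.
rewrite -(pair_bigA _ (fun p q : 'I_m =>
  `[< maximal_run N p q >] && (f p (+) g q))) /=.
under eq_bigr do under eq_bigr do rewrite andb_addr.
under eq_bigr do rewrite big_split /=.
rewrite !big_split /=; congr (_ (+) _); last rewrite exchange_big /=.
- apply: eq_bigr => p _.
  have [/andP[np np1]|nst] := boolP (~~ N p && N p.+1).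
    have [q qm h] := maximal_run_exr (ltn_ord p) nm np np1.
    rewrite (@big_addb_unique _ _ (Ordinal qm)) /=; first by rewrite (asboolT h).
    move=> t /andP[/asboolP ht _]; apply: val_inj => /=.
    exact: maximal_run_uniqr ht h.
  rewrite big1 // => q _.
  apply/negbTE/negP => /andP[/asboolP /maximal_run_start].
  by rewrite (negbTE nst).
- apply: eq_bigr => q _.
  have [/andP[nq nq1]|nst] := boolP (N q && ~~ N q.+1).
    have [p pq h] := maximal_run_exl n0 nq nq1.
    have pm := ltn_trans pq (ltn_ord q).
    rewrite (@big_addb_unique _ _ (Ordinal pm)) /=; first by rewrite (asboolT h).
    move=> t /andP[/asboolP ht _]; apply: val_inj => /=.
    exact: maximal_run_uniql ht h.
  rewrite big1 // => p _.
  apply/negbTE/negP => /andP[/asboolP /maximal_run_end].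
  by rewrite (negbTE nst).
Qed.

(** * From a traversal to a normal ruling *)

Section Eyes.
Variables (D : diagram) (rho : pred nat).
Hypothesis fD : front D.
Hypothesis subD : forall i, rho i -> exists k, onth D i = Some (xing k).
Hypothesis runD : valid_run D rho id.

Local Notation P := (state D rho id).
Local Notation n := (nstrands D).

Lemma nstrandsS i e : onth D i = Some e -> n i.+1 = cross_event (n i) e.
Proof.
rewrite /nstrands; elim: D 0 i => [|e' D' IH] m [|i] //=.
  by case=> ->; rewrite take0.
exact: IH.
Qed.

Lemma nstrands_fit i e : onth D i = Some e -> height e + nin (kind_of e) <= n i.
Proof.
have: fits 0 D by move: fD; rewrite /front front_fromE => /andP[].
rewrite /nstrands; elim: D 0 i => [|e' D' IH] m [|i] //= /andP[h f].
  by case=> <-.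
exact: IH.
Qed.

Lemma onth_size i e : onth D i = Some e -> i < size D.
Proof. by elim: D i => [|e' D' IH] [|i] //= /IH. Qed.

Lemma onth_lt i : i < size D -> exists e, onth D i = Some e.
Proof. by elim: D i => [|e' D' IH] [|i] //=; [exists e' | apply: IH]. Qed.

Lemma nstrands_size i : size D <= i -> n i = 0.
Proof.
move=> iD; rewrite /nstrands take_oversize //.
by move: fD; rewrite /front front_fromE => /andP[_ /eqP].
Qed.

Lemma nstrands_lt i j : j < n i -> i < size D.
Proof.
by move=> jn; case: (ltnP i (size D)) => // /nstrands_size e; rewrite e in jn.
Qed.

Lemma strand_event i j : j < n i.+1 -> exists e, onth D i = Some e.
Proof. by move/nstrands_lt/ltnW/onth_lt. Qed.

Lemma state_after i e : onth D i = Some e -> P i.+1 = after e (rho i) (P i).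
Proof. exact: stateS. Qed.

Lemma state_matches i : i <= size D -> matches (n i) (P i).
Proof.
elim: i => [_|i IH iD].
  rewrite /nstrands take0; have -> : P 0 = id by case: (D).
  exact: matches_id.
have [e De] := onth_lt iD.
rewrite (state_after De) (nstrandsS De).
apply: matches_after; [exact: nstrands_fit | | exact: runD].
by apply: IH; apply: ltnW.
Qed.

Lemma strand_matches i j : j < n i -> matches (n i) (P i).
Proof. by move/nstrands_lt/ltnW/state_matches. Qed.

(** The label of a strand is the position of the left cusp that begins its eye,
    found by following the eye to the left. *)
Fixpoint label (i : nat) : nat -> nat :=
  if i is i'.+1 then
    match onth D i' with
    | Some (lcusp k) => fun j =>
        if (j == k) || (j == k.+1) then i' else label i' (unskip k j)
    | Some (rcusp k) => fun j => label i' (skip k j)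
    | Some (xing k) => fun j => label i' (if rho i' then j else swap k j)
    | None => label i'
    end
  else id.

Lemma label_opened i k j : onth D i = Some (lcusp k) ->
  label i.+1 (skip k j) = label i j.
Proof. by move=> /= ->; rewrite !skip_neq skipK. Qed.

Lemma label_lower i k : onth D i = Some (lcusp k) -> label i.+1 k = i.
Proof. by move=> /= ->; rewrite eqxx. Qed.

Lemma label_upper i k : onth D i = Some (lcusp k) -> label i.+1 k.+1 = i.
Proof. by move=> /= ->; rewrite eqxx orbT. Qed.

Lemma label_unopened i k j : onth D i = Some (rcusp k) ->
  label i.+1 j = label i (skip k j).
Proof. by move=> /= ->. Qed.

Lemma label_crossed i k j : onth D i = Some (xing k) ->
  label i.+1 j = label i (if rho i then j else swap k j).
Proof. by move=> /= ->. Qed.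

Arguments label : simpl never.

Lemma label_lt i j : j < n i -> label i j < i.
Proof.
elim: i j => [|i IH] j; first by rewrite /nstrands take0.
move=> jn; have [e De] := strand_event jn.
move: jn; rewrite (nstrandsS De); have := nstrands_fit De.
case: e De => -[] k De; rewrite /cross_event /= => kn jn.
- rewrite addn0 in kn; case: (skipP k j) jn => [||j0] jn.
  + by rewrite (label_lower De).
  + by rewrite (label_upper De).
  + rewrite (label_opened _ De); apply: ltnW; apply: IH.
    by rewrite -(skip_ltn j0 kn); lia.
- rewrite (label_crossed _ De); apply: ltnW; apply: (leq_trans (IH _ _)) => //.
  by case: (rho i); rewrite ?swap_lt; lia.
- rewrite (label_unopened _ De); apply: ltnW; apply: (leq_trans (IH _ _)) => //.
  by rewrite /skip; case: ifP; lia.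
Qed.

Lemma label_eq i j j' : j < n i -> j' < n i ->
  (label i j == label i j') = (j' == j) || (j' == P i j).
Proof.
elim: i j j' => [|i IH] j j'; first by rewrite /nstrands take0.
move=> jn jn'; have [e De] := strand_event jn.
have mp := state_matches (ltnW (onth_size De)).
have := runD De; rewrite (state_after De).
have := nstrands_fit De.
move: jn jn'; rewrite (nstrandsS De).
case: e De => -[] k De; rewrite /cross_event /= => jn jn' kn.
- rewrite subn0 addn2 addn0 in jn jn' kn.
  move=> _; rewrite /after /=.
  have lt j0 : skip k j0 < (n i).+2 -> label i j0 < i.
    by rewrite skip_ltn // => /label_lt.
  case: (skipP k j) jn => [||j0]; case: (skipP k j') jn' => [||j1] hj' hj;
    rewrite ?openedl ?openedr ?opened_skip ?(label_lower De) ?(label_upper De)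
      ?(label_opened _ De) ?skip_neq ?eqxx ?orbT //.
  + by rewrite gtn_eqF ?lt.
  + by rewrite gtn_eqF ?lt.
  + by rewrite ltn_eqF ?lt // ![_ == skip _ _]eq_sym !skip_neq.
  + by rewrite ltn_eqF ?lt // ![_ == skip _ _]eq_sym !skip_neq.
  + by rewrite !(can_eq (@skipK k)); apply: IH; rewrite -(skip_ltn _ kn).
- rewrite !(label_crossed _ De) /admits /after /=.
  have e2 : n i - 2 + 2 = n i by lia.
  rewrite e2 in jn jn'.
  case: (rho i) => _; first exact: IH.
  rewrite IH ?swap_lt //; try lia.
  by rewrite (can_eq (@swapK k)) (can2_eq (@swapK k) (@swapK k)) /crossed.
- rewrite addn0 in jn jn'.
  rewrite !(label_unopened _ De) /admits /after /= => /andP[_ /eqP pk].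
  have lt j0 : j0 < n i - 2 -> skip k j0 < n i.
    by have := @skip_ltn (n i - 2) k j0; lia.
  rewrite IH ?lt // -(skip_unopened _ mp pk).
  by rewrite !(can_eq (@skipK k)).
Qed.

Lemma joined_label s s' : joined D rho s s' ->
  (s.2 < n s.1) = (s'.2 < n s'.1) /\
  (s.2 < n s.1 -> label s.1 s.2 = label s'.1 s'.2).
Proof.
case=> /= i.
- move=> j e De je; rewrite (nstrandsS De); have := nstrands_fit De.
  rewrite /cross_event => kn; split; first by case: (kind_of e) kn => /=; lia.
  case: e De je kn => -[] k De /= je kn jn.
  + by rewrite -(label_opened j De); congr label; rewrite /skip; split_ifs; lia.
  + rewrite (label_crossed _ De); case: (rho i) => //.
    by rewrite swap_id //; lia.
  + by rewrite (label_unopened _ De); congr label; rewrite /skip; split_ifs; lia.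
- move=> j e De; rewrite (nstrandsS De); have := nstrands_fit De.
  rewrite /cross_event => kn; split; first by case: (kind_of e) kn => /=; lia.
  case: e De kn => -[] k De /= kn jn.
  + by rewrite -(label_opened _ De); congr label; rewrite /skip; split_ifs; lia.
  + rewrite (label_crossed _ De); case: (rho i) => //.
    by rewrite swap_id //; lia.
  + by rewrite (label_unopened _ De); congr label; rewrite /skip; split_ifs; lia.
- move=> k De; rewrite (nstrandsS De); have := nstrands_fit De.
  rewrite /cross_event /= => kn; split; first lia.
  by rewrite (label_lower De) (label_upper De).
- move=> k De; have /= := nstrands_fit De.
  move=> kn; split; first lia.
  move=> k1; apply/eqP; rewrite label_eq //; try lia.
  by have := runD De; rewrite /admits /= => /andP[_ /eqP ->]; rewrite eqxx orbT.
- move=> k De nr; rewrite (nstrandsS De); have := nstrands_fit De.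
  rewrite /cross_event /= => kn; split; first lia.
  by rewrite (label_crossed _ De) (negbTE nr) swapr.
- move=> k De nr; rewrite (nstrandsS De); have := nstrands_fit De.
  rewrite /cross_event /= => kn; split; first lia.
  by rewrite (label_crossed _ De) (negbTE nr) swapl.
- move=> k De nr; rewrite (nstrandsS De); have := nstrands_fit De.
  rewrite /cross_event /= => kn; split; first lia.
  by rewrite (label_crossed _ De) nr.
- move=> k De nr; rewrite (nstrandsS De); have := nstrands_fit De.
  rewrite /cross_event /= => kn; split; first lia.
  by rewrite (label_crossed _ De) nr.
Qed.

Local Notation connected := (clos_refl_sym_trans segment (joined D rho)).

Definition eye (c : nat) : set segment :=
  [set s | s.2 < n s.1 /\ label s.1 s.2 = c].

Lemma connected_eye s s' c : connected s s' -> eye c s <-> eye c s'.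
Proof.
elim=> [{}s {}s' /joined_label[h1 h2]|//|{}s {}s' _ -> //|x y z _ -> _ -> //].
by rewrite /eye /= -h1; split=> -[v <-]; rewrite h2.
Qed.

Lemma joined_over i e j j0 : onth D i = Some e ->
  j0 >= height e + nin (kind_of e) ->
  j + nin (kind_of e) = j0 + nout (kind_of e) -> joined D rho (i, j0) (i.+1, j).
Proof.
move=> De h1 h2.
have := joined_above rho (j0 - (height e + nin (kind_of e))) De.
congr (joined _ _ (_, _) (_, _)); lia.
Qed.

(** A label determines a single component: every strand is connected to the left
    cusp that its label designates. *)
Lemma connected_cusp i j : j < n i ->
  exists k, onth D (label i j) = Some (lcusp k) /\
            connected ((label i j).+1, k) (i, j).
Proof.
elim: i j => [|i IH] j; first by rewrite /nstrands take0.
move=> jn; have [e De] := strand_event jn.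
have step j0 : j0 < n i -> label i.+1 j = label i j0 ->
    joined D rho (i, j0) (i.+1, j) ->
    exists k, onth D (label i.+1 j) = Some (lcusp k) /\
              connected ((label i.+1 j).+1, k) (i.+1, j).
  move=> /IH[k [h1 h2]] -> h3; exists k; split=> //.
  by apply: rst_trans h2 _; apply: rst_step.
move: jn; rewrite (nstrandsS De); have := nstrands_fit De.
case: e De => -[] k De; rewrite /cross_event /= => kn jn.
- case: (skipP k j) jn step => [||j0] jn step.
  + rewrite (label_lower De); exists k; split=> //; exact: rst_refl.
  + rewrite (label_upper De); exists k; split=> //.
    by apply: rst_step; apply: joined_left_cusp.
  + apply: (step j0); first by rewrite -(@skip_ltn _ k); lia.
      exact: label_opened.
    rewrite /skip; case: ifP => jk; first exact: (joined_below _ De).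
    by apply: (joined_over De) => /=; lia.
- have e2 : n i - 2 + 2 = n i by lia.
  rewrite e2 in jn.
  apply: (step (if rho i then j else swap k j)).
  + by case: (rho i); rewrite ?swap_lt //; lia.
  + exact: label_crossed.
  + have [->|jk] := eqVneq j k.
      rewrite swapl; case: ifPn => rk; first exact: joined_resolved_lower.
      exact: joined_crossing_down.
    have [->|jk1] := eqVneq j k.+1.
      rewrite swapr; case: ifPn => rk; first exact: joined_resolved_upper.
      exact: joined_crossing_up.
    rewrite swap_id // if_same.
    have [lt|ge] := ltnP j k; first exact: (joined_below _ De).
    by apply: (joined_over De) => /=; lia.
- apply: (step (skip k j)); first by have := @skip_ltn (n i - 2) k j; lia.
    exact: label_unopened.
  rewrite /skip; case: ifP => jk; first exact: (joined_below _ De).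
  by apply: (joined_over De) => /=; lia.
Qed.

Lemma cusp_strand i k : onth D i = Some (lcusp k) -> k.+1 < n i.+1.
Proof.
by move=> De; rewrite (nstrandsS De); have := nstrands_fit De;
  rewrite /cross_event /=; lia.
Qed.

Lemma connectedE s : s.2 < n s.1 ->
  [set s' | connected s s'] = eye (label s.1 s.2).
Proof.
move=> sv; apply/seteqP; split=> [s' /= h|[i j] /= [jn e]].
  by apply/(connected_eye _ h).
have [k [De h1]] := connected_cusp sv; have [k' [De' h2]] := connected_cusp jn.
rewrite -surjective_pairing in h1; rewrite e in De' h2.
move: De'; rewrite De => -[ek]; rewrite -ek in h2.
exact: rst_trans (rst_sym _ _ _ _ h1) h2.
Qed.

Lemma componentP E : component D rho E <->
  exists2 c, (exists k, onth D c = Some (lcusp k)) & E = eye c.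
Proof.
split=> [[s [sv ->]]|[c [k De] ->]].
  have [k [? _]] := connected_cusp sv.
  by rewrite connectedE //; exists (label s.1 s.2) => //; exists k.
exists (c.+1, k); have sv := cusp_strand De.
by split; [|rewrite connectedE //= ?(label_lower De) //]; apply: ltnW.
Qed.

Lemma component_strand i j : j < n i -> component D rho (eye (label i j)).
Proof.
move=> jn; have [k [De _]] := connected_cusp jn.
by apply/componentP; exists (label i j) => //; exists k.
Qed.

Lemma eye_strand i j c : j < n i -> label i j = c ->
  forall j', eye c (i, j') <-> j' = j \/ j' = P i j.
Proof.
move=> jn <- j'; rewrite /eye /=; split.
  by case=> jn' /eqP; rewrite eq_sym label_eq // => /orP[]/eqP ->; [left|right].
move=> h; have jn' : j' < n i.
  by case: h => -> //; rewrite (matches_lt _ (strand_matches jn)).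
split=> //; apply/eqP; rewrite eq_sym label_eq //.
by case: h => ->; rewrite eqxx ?orbT.
Qed.

Lemma eye_spans i j c : j < n i -> label i j = c ->
  spans (eye c) i (minn j (P i j)) (maxn j (P i j)).
Proof.
move=> jn lj; have := matches_neq (strand_matches jn) jn.
split; first by lia.
move=> j'; rewrite (eye_strand jn lj); lia.
Qed.

Lemma spans_unique E i l u l' u' : spans E i l u -> spans E i l' u' ->
  l' = l /\ u' = u.
Proof.
move=> [lu h] [lu' h'].
have := (h l').1 ((h' l').2 (or_introl erefl)).
have := (h u').1 ((h' u').2 (or_intror erefl)).
by lia.
Qed.

Lemma spans_strand c i l u : spans (eye c) i l u ->
  [/\ l < n i, label i l = c, u < n i, label i u = c & P i l = u].
Proof.
move=> [lu h].
have [/= ln ll] := (h l).2 (or_introl erefl).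
have [/= un ul] := (h u).2 (or_intror erefl).
split=> //; have := label_eq ln un; rewrite ll ul eqxx.
by move=> h1; move: lu; case/orP: (esym h1) => /eqP ->; rewrite ?ltnn.
Qed.

Definition present c i := exists2 j, j < n i & label i j = c.

Lemma present_back c i : present c i.+1 -> c != i -> present c i.
Proof.
case=> j jn <- ci; have [e De] := strand_event jn.
move: jn ci; rewrite (nstrandsS De); have := nstrands_fit De.
case: e De => -[] k De; rewrite /cross_event /= => kn jn.
- case: (skipP k j) jn => [||j0] jn;
    rewrite ?(label_lower De) ?(label_upper De) ?eqxx //.
  rewrite (label_opened _ De) => _; exists j0 => //.
  by rewrite -(@skip_ltn _ k); lia.
- move=> _; rewrite (label_crossed _ De).
  exists (if rho i then j else swap k j) => //.
  by case: (rho i); rewrite ?swap_lt //; lia.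
- move=> _; rewrite (label_unopened _ De); exists (skip k j) => //.
  by have := @skip_ltn (n i - 2) k j; lia.
Qed.

Lemma present_forth c i : present c i -> present c i.+1 \/
  exists2 k, onth D i = Some (rcusp k) & label i k = c.
Proof.
case=> j jn <-; have [e De] := onth_lt (nstrands_lt jn).
have := nstrands_fit De; have := nstrandsS De; have := runD De.
case: e De => -[] k De; rewrite /cross_event /= => adm nS kn.
- left; exists (skip k j); last exact: label_opened.
  by have := @skip_ltn (n i) k j; lia.
- left; exists (if rho i then j else swap k j).
    by case: (rho i); rewrite ?swap_lt //; lia.
  by rewrite (label_crossed _ De); case: (rho i); rewrite ?swapK.
- case: (skipP k j) jn => [||j0] jn.
  + by right; exists k.
  + right; exists k => //; apply/eqP; rewrite label_eq //; last by lia.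
    by move: adm; rewrite /admits /= => /andP[_ /eqP ->]; rewrite eqxx orbT.
  + left; exists j0; last exact: label_unopened.
    by have := @skip_ltn (n i - 2) k j0; lia.
Qed.

(** The two strands that meet at a right cusp are matched, hence they are all the
    strands with their label. *)
Lemma rcusp_absent i k : onth D i = Some (rcusp k) ->
  ~ present (label i k) i.+1.
Proof.
move=> De [j jn]; rewrite (label_unopened _ De) => /eqP.
have := nstrands_fit De; have := nstrandsS De; have := runD De.
rewrite /admits /cross_event /= => /andP[_ /eqP pk] nS kn.
rewrite eq_sym label_eq; try lia.
  by rewrite pk !skip_neq.
by have := @skip_ltn (n i - 2) k j; lia.
Qed.

Lemma absent_after c i m : c < i -> ~ present c i -> i <= m -> ~ present c m.
Proof.
move=> ci np; elim: m => [|m IH]; first by rewrite leqn0 => /eqP e; rewrite -e.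
rewrite leq_eqVlt => /orP[/eqP <- //|im] /present_back h.
by apply: IH => //; apply: h; lia.
Qed.

Lemma run_normal_ruling : normal_ruling D rho.
Proof.
split.
- by move=> i /subD.
- move=> E /componentP[c [k Dc] ->]; split.
  + exists c; split.
      exists k => //; rewrite /eye /=.
      by split; [apply/ltnW/cusp_strand | exact: label_lower].
    by move=> i [k' Di [_ /=]]; rewrite (label_lower Di).
  + have pc : present c c.+1.
      by exists k; [apply/ltnW/cusp_strand | exact: label_lower].
    (* Without a right cusp, the label would survive to the last slice. *)
    have [i [ci [k' Di lk]]] : exists i, c < i /\
        exists2 k', onth D i = Some (rcusp k') & label i k' = c.
      have [//|nex] := pselect (exists i, c < i /\
        exists2 k', onth D i = Some (rcusp k') & label i k' = c).
      have all m : present c (c.+1 + m).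
        elim: m => [|m IH]; first by rewrite addn0.
        rewrite addnS; have [//|h] := present_forth IH.
        by case: nex; exists (c.+1 + m); split=> //; lia.
      have [j jn _] := all (size D).
      by move: jn; rewrite nstrands_size //; lia.
    exists i; split.
      exists k' => //; rewrite /eye /=; split=> //.
      by have := nstrands_fit Di; rewrite /=; lia.
    move=> i' [k2 Di' [/= kn' lk']].
    have abs := rcusp_absent Di; rewrite lk in abs.
    have abs' := rcusp_absent Di'; rewrite lk' in abs'.
    have ci' : c < i' by rewrite -lk'; apply: label_lt.
    case: (ltngtP i i') => // ii.
      by case: (@absent_after c i.+1 i') => //; [lia | exists k2].
    case: (@absent_after c i'.+1 i) => //; first lia.
    by exists k' => //; have := nstrands_fit Di; rewrite /=; lia.
  + case=> i [k' [Di nr [/= kn lk] [/= kn' lk']]].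
    have := runD Di; rewrite /admits /= (negbTE nr) => /eqP; apply.
    have := label_eq kn kn'; rewrite lk lk' eqxx => h1.
    by case/orP: (esym h1) => /eqP e; [lia | rewrite -e].
- move=> i k Di ri; have := runD Di; rewrite /admits /= ri => sw.
  have /= kn := nstrands_fit Di.
  have kn0 : k < n i by lia.
  have kn1 : k.+1 < n i by lia.
  have neq := matches_neq (strand_matches kn0).
  exists (eye (label i k)), (eye (label i k.+1)); split.
  + exact: component_strand.
  + exact: component_strand.
  + by [].
  + by [].
  + split.
      move=> e; have : eye (label i k) (i, k.+1) by rewrite e.
      rewrite (eye_strand kn0 erefl); move: sw; rewrite /switchable; lia.
    exists (minn k (P i k)), (maxn k (P i k)),
      (minn k.+1 (P i k.+1)), (maxn k.+1 (P i k.+1)).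
    split; [exact: eye_spans | exact: eye_spans |].
    move: sw; rewrite /switchable /disjoint_or_nested.
    case/or3P => /andP[s1 s2]; [apply: Or41 | apply: Or44 | apply: Or43]; lia.
Qed.

(** * Counting the clasps *)

(** The pairs [x, x'] and [y, y'] are interleaved, whatever the order within each
    pair: exactly one of [y] and [y'] lies between [x] and [x']. *)
Definition interleave x x' y y' :=
  (x < y) (+) (x' < y) (+) (x < y') (+) (x' < y').

Definition interleaved a b i := `[< non_nested (eye a) (eye b) i >].

Lemma interleavedE a b i j j' : a != b -> j < n i -> label i j = a ->
  j' < n i -> label i j' = b ->
  interleaved a b i = interleave j (P i j) j' (P i j').
Proof.
move=> ab jn la jn' lb.
have n1 := matches_neq (strand_matches jn) jn.
have n2 := matches_neq (strand_matches jn') jn'.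
have /negP : ~~ ((j' == j) || (j' == P i j)) by rewrite -label_eq // la lb.
have /negP : ~~ ((j == j') || (j == P i j')).
  by rewrite -label_eq // la lb eq_sym.
have : P i j <> P i j'.
  by move/(matches_inj (strand_matches jn)) => e; rewrite -la -lb e eqxx in ab.
move=> n3 n4 n5; apply/asboolP/idP.
  case=> l [u [l' [u' [/spans_unique h1 /spans_unique h2]]]].
  have [<- <-] := h1 _ _ (eye_spans jn la).
  have [<- <-] := h2 _ _ (eye_spans jn' lb).
  by rewrite /interleave; case; lia.
move=> h; exists (minn j (P i j)), (maxn j (P i j)),
  (minn j' (P i j')), (maxn j' (P i j')).
split; [exact: eye_spans | exact: eye_spans |].
by move: h; rewrite /interleave; lia.
Qed.

Lemma interleaved_present a b i :
  interleaved a b i -> present a i /\ present b i.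
Proof.
case/asboolP => l [u [l' [u' [sl sl' _]]]].
by split; [exists l | exists l']; case: (spans_strand sl) (spans_strand sl')
  => [? ? _ _ _] [].
Qed.

Lemma interleaved_sym a b i : interleaved a b i = interleaved b a i.
Proof.
by apply/asbool_equiv_eq; split=> -[l [u [l' [u' [h1 h2 h3]]]]];
  exists l', u', l, u; split=> //; rewrite or_comm.
Qed.

Lemma interleaved_adjacent a b i j : a != b -> j < n i -> label i j = a ->
  P i j = j.+1 -> interleaved a b i = false.
Proof.
move=> ab jn la pj; apply/negP => h.
have [_ [j' jn' lb]] := interleaved_present h.
move: h; rewrite (interleavedE ab jn la jn' lb) pj /interleave.
have /negP : ~~ ((j' == j) || (j' == P i j)) by rewrite -label_eq // la lb.
have /negP : ~~ ((j == j') || (j == P i j')).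
  by rewrite -label_eq // la lb eq_sym.
have : P i j <> P i j'.
  by move/(matches_inj (strand_matches jn)) => e; rewrite -la -lb e eqxx in ab.
by rewrite pj; lia.
Qed.

Lemma interleave_swap k x x' y y' :
  uniq [:: x; x'; y; y'] ->
  ~~ ((k \in [:: x; x']) && (k.+1 \in [:: x; x'])) ->
  ~~ ((k \in [:: y; y']) && (k.+1 \in [:: y; y'])) ->
  interleave (swap k x) (swap k x') (swap k y) (swap k y') =
  interleave x x' y y' (+)
  ((k \in [:: x; x']) && (k.+1 \in [:: y; y']) ||
   (k \in [:: y; y']) && (k.+1 \in [:: x; x'])).
Proof.
rewrite /interleave !swap_ltE /= !inE ![k == _]eq_sym ![k.+1 == _]eq_sym => d.
have e u v : u != v ->
    ~~ ((u == k) && (v == k)) /\ ~~ ((u == k.+1) && (v == k.+1)).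
  by lia.
have f u : ~~ ((u == k) && (u == k.+1)) by lia.
move: d; rewrite !negb_or !andbT => /and3P[].
move=> /and3P[/e[] + + /e[] + + /e[]] + + /andP[/e[] + + /e[]] + + /e[].
(* What remains is propositional in the positions of the four strands. *)
move: (f x) (f x') (f y) (f y').
move: (x < y) (x' < y) (x < y') (x' < y') => a1 a2 a3 a4.
move: (x == k) (x' == k) (y == k) (y' == k).
move: (x == k.+1) (x' == k.+1) (y == k.+1) (y' == k.+1).
by do 8 (case=> //=); case: a1; case: a2; case: a3; case: a4.
Qed.

Definition meets a b i : bool :=
  if onth D i is Some (xing k) then
    ~~ rho i && ((label i k == a) && (label i k.+1 == b) ||
                 (label i k == b) && (label i k.+1 == a))
  else false.

(** An eye is not interleaved with any other where it begins or ends, because its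
    two strands are adjacent there. *)
Lemma interleaved_birth a b i :
  a != b -> ~ present a i -> interleaved a b i.+1 = false.
Proof.
move=> ab na; apply/negP => h; have [pa pb] := interleaved_present h.
have [ai|ai] := eqVneq a i; last by apply: na; exact: present_back.
case: pa => j jn la; have [e De] := strand_event jn.
have := nstrands_fit De; have := nstrandsS De; have := state_after De.
case: e De => -[] k De; rewrite /cross_event /after /= => PS nS kn.
- have := cusp_strand De => kn1.
  move: h; rewrite (@interleaved_adjacent a b i.+1 k) //; first by lia.
    by rewrite (label_lower De) ai.
  by rewrite PS openedl.
- have : label i (if rho i then j else swap k j) < i.
    by apply: label_lt; case: (rho i); rewrite ?swap_lt; lia.
  by rewrite -(label_crossed _ De) la ai ltnn.
- have : label i (skip k j) < i.
    by apply: label_lt; have := @skip_ltn (n i - 2) k j; lia.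
  by rewrite -(label_unopened _ De) la ai ltnn.
Qed.

Lemma interleaved_death a b i :
  a != b -> ~ present a i.+1 -> interleaved a b i = false.
Proof.
move=> ab na; apply/negP => h; have [pa pb] := interleaved_present h.
have [//|[k De lk]] := present_forth pa.
have /= kn := nstrands_fit De.
move: h; rewrite (@interleaved_adjacent a b i k) //; first by lia.
by have := runD De; rewrite /admits /= => /andP[_ /eqP].
Qed.

Lemma meets_present a b i : meets a b i -> present a i /\ present b i.
Proof.
rewrite /meets; case De: (onth D i) => [[[] k]|] //.
have /= kn := nstrands_fit De.
have k0 : k < n i by lia.
have k1 : k.+1 < n i by lia.
by case/andP => _ /orP[]/andP[/eqP <- /eqP <-]; split;
  by [exists k | exists k.+1].
Qed.

Lemma meets_sym a b i : meets a b i = meets b a i.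
Proof. by rewrite /meets; case: (onth D i) => [[[] k]|] //; rewrite orbC. Qed.

Lemma meets_present_next a b i : meets a b i -> present a i.+1.
Proof.
move=> h; have [pa _] := meets_present h; move: h.
rewrite /meets; case De: (onth D i) => [[[] k]|] // _.
have [//|[k' De' _]] := present_forth pa; by rewrite De in De'.
Qed.

(** An event preserves the order of the strands that survive it, except for the two
    strands of an unresolved crossing. *)
Lemma interleaved_next a b i : a != b ->
  interleaved a b i.+1 = interleaved a b i (+) meets a b i.
Proof.
move=> ab; have ba : b != a by rewrite eq_sym.
have [pa|na] := pselect (present a i); last first.
  rewrite (interleaved_birth ab na).
  have -> : interleaved a b i = false by apply/negP => /interleaved_present[].
  by symmetry; apply/negP => /meets_present[].
have [pb|nb] := pselect (present b i); last first.
  rewrite [interleaved a b i.+1]interleaved_sym (interleaved_birth ba nb).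
  have -> : interleaved a b i = false by apply/negP => /interleaved_present[].
  by symmetry; apply/negP => /meets_present[].
have [pa'|na] := pselect (present a i.+1); last first.
  rewrite (interleaved_death ab na).
  have -> : interleaved a b i.+1 = false.
    by apply/negP => /interleaved_present[].
  by symmetry; apply/negP => /meets_present_next.
have [pb'|nb] := pselect (present b i.+1); last first.
  rewrite [interleaved a b i]interleaved_sym (interleaved_death ba nb).
  have -> : interleaved a b i.+1 = false.
    by apply/negP => /interleaved_present[].
  by symmetry; apply/negP; rewrite meets_sym => /meets_present_next.
case: pa pb pa' pb' => ja jan la [jb jbn lb] [ja' jan' la'] [jb' jbn' lb'].
have [e De] := onth_lt (nstrands_lt jan).
have mp := strand_matches jan.
have := nstrands_fit De; have := nstrandsS De.
have := state_after De; have := runD De.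
rewrite /meets De; case: e De => -[] k De;
  rewrite /cross_event /after /admits /= => adm PS nS kn.
- rewrite addbF (@interleavedE a b i.+1 (skip k ja) (skip k jb)) //
    ?(label_opened _ De) //; first last.
    by have := @skip_ltn (n i) k jb; lia.
    by have := @skip_ltn (n i) k ja; lia.
  rewrite (interleavedE ab jan la jbn lb) PS !opened_skip.
  by rewrite /interleave !skip_lt.
- have nS' : n i.+1 = n i by lia.
  case: (boolP (rho i)) => ri /=.
    rewrite ri in PS; rewrite addbF (interleavedE ab jan la jbn lb).
    rewrite (@interleavedE a b i.+1 ja jb) ?nS' //; rewrite ?PS //.
      by rewrite (label_crossed _ De) ri.
    by rewrite (label_crossed _ De) ri.
  rewrite (negbTE ri) in PS adm.
  rewrite (@interleavedE a b i.+1 (swap k ja) (swap k jb)) ?nS' ?swap_lt //;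
    try lia; first last.
    by rewrite (label_crossed _ De) (negbTE ri) swapK.
    by rewrite (label_crossed _ De) (negbTE ri) swapK.
  rewrite (interleavedE ab jan la jbn lb) PS /crossed !swapK.
  have k0 : k < n i by lia.
  have k1 : k.+1 < n i by lia.
  have mem u j : u < n i -> j < n i ->
      (u \in [:: j; P i j]) = (label i u == label i j).
    by move=> un jn; rewrite eq_sym label_eq // !inE.
  have n1 := matches_neq mp jan.
  have n2 := matches_neq mp jbn.
  have /negP n3 : ~~ ((jb == ja) || (jb == P i ja)).
    by rewrite -label_eq // la lb.
  have /negP n4 : ~~ ((ja == jb) || (ja == P i jb)).
    by rewrite -label_eq // la lb eq_sym.
  have n5 : P i ja <> P i jb.
    by move/(matches_inj mp) => e; rewrite -la -lb e eqxx in ab.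
  have kk : label i k != label i k.+1.
    by rewrite label_eq // negb_or [_ == P i k]eq_sym adm andbT; lia.
  rewrite interleave_swap.
  + by rewrite !mem // la lb.
  + by rewrite /= !inE; lia.
  + by rewrite !mem //; apply: contra kk => /andP[/eqP -> /eqP ->].
  + by rewrite !mem //; apply: contra kk => /andP[/eqP -> /eqP ->].
- rewrite addbF (interleavedE ab jan' la' jbn' lb').
  rewrite (@interleavedE a b i (skip k ja') (skip k jb')) //
    -?(label_unopened _ De) //; first last.
    by have := @skip_ltn (n i - 2) k jb'; lia.
    by have := @skip_ltn (n i - 2) k ja'; lia.
  have [_ /eqP pk] := andP adm.
  by rewrite PS /interleave -!(skip_unopened _ mp pk) !skip_lt.
Qed.

(** One of the two strands is the upper strand of its eye and the other one the
    lower strand: for an unresolved crossing, this is type M. *)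
Definition mixed i : bool :=
  if onth D i is Some (xing k) then (P i k < k) (+) (P i k.+1 < k.+1)
  else false.

(** At a crossing of two eyes, the beginning of an interval and type M add up to
    the comparison of the two matched strands. *)
Lemma meets_weight a b i : a != b -> meets a b i ->
  ~~ interleaved a b i (+) mixed i = run_weight D rho id i.
Proof.
move=> ab; rewrite /meets /mixed /run_weight.
case De: (onth D i) => [[[] k]|] //.
case/andP => ri lab; have := runD De.
rewrite /admits /weight /= ri (negbTE ri) /= => adm.
have /= kn := nstrands_fit De.
have k0 : k < n i by lia.
have k1 : k.+1 < n i by lia.
have n1 := matches_neq (strand_matches k0) k0.
have n2 := matches_neq (strand_matches k0) k1.
have n3 : P i k <> P i k.+1 by move/(matches_inj (strand_matches k0)); lia.
have n4 : P i k.+1 <> k.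
  by move=> e; move: adm; rewrite -{1}e (strand_matches k0).1 eqxx.
have -> : interleaved a b i = interleave k (P i k) k.+1 (P i k.+1).
  case/orP: lab => /andP[/eqP l1 /eqP l2]; first exact: interleavedE.
  by rewrite interleaved_sym; apply: interleavedE; rewrite // eq_sym.
by rewrite /interleave; lia.
Qed.

Lemma cross_with_typeP a b i : meets a b i ->
  (exists t, cross_with_type D rho (eye a) (eye b) i t) /\
  forall t, cross_with_type D rho (eye a) (eye b) i t -> t = TypeM <-> mixed i.
Proof.
rewrite /meets /mixed; case De: (onth D i) => [[[] k]|] //.
case/andP => ri lab; have := runD De; rewrite /admits /= (negbTE ri) /= => adm.
have /= kn := nstrands_fit De.
have k0 : k < n i by lia.
have k1 : k.+1 < n i by lia.
have mp := strand_matches k0.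
have n1 := matches_neq mp k0.
have n2 := matches_neq mp k1.
have n3 : P i k <> P i k.+1 by move/(matches_inj mp); lia.
have n4 : P i k.+1 <> k.
  by move=> e; move: adm; rewrite -{1}e mp.1 eqxx.
have sp c j : j < n i -> label i j == c ->
    spans (eye c) i (minn j (P i j)) (maxn j (P i j)).
  by move=> jn /eqP; apply: eye_spans.
suff gen j j' c c' : spans (eye c) i (minn j (P i j)) (maxn j (P i j)) ->
    spans (eye c') i (minn j' (P i j')) (maxn j' (P i j')) ->
    (j = k /\ j' = k.+1) \/ (j = k.+1 /\ j' = k) ->
    (exists t, cross_with_type D rho (eye c) (eye c') i t) /\
    forall t, cross_with_type D rho (eye c) (eye c') i t ->
      t = TypeM <-> (P i k < k) (+) (P i k.+1 < k.+1).
  case/orP: lab => /andP[l1 l2].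
    by apply: (gen k k.+1); [exact: sp | exact: sp | left].
  by apply: (gen k.+1 k); [exact: sp | exact: sp | right].
move=> s1 s2 jj; split.
  exists (if (P i k < k) (+) (P i k.+1 < k.+1) then TypeM
          else if P i k < k then TypeT else TypeB).
  exists k, (minn j (P i j)), (maxn j (P i j)),
    (minn j' (P i j')), (maxn j' (P i j')).
  split=> //; rewrite /same_pair; case: jj => -[-> ->].
    by case: ltnP => h1; case: ltnP => h2 /=; lia.
  by case: ltnP => h1; case: ltnP => h2 /=; lia.
move=> t [k' [l [u [l' [u' [De' _ /spans_unique h1 /spans_unique h2 ht]]]]]].
move: De'; rewrite De => -[ek]; subst k'.
have [e1 e2] := h1 _ _ s1; have [e3 e4] := h2 _ _ s2.
move: ht; rewrite -e1 -e2 -e3 -e4 /same_pair.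
case: jj => -[-> ->]; case: t => ht; split=> //; lia.
Qed.

Lemma carries_claspE a b p q : a != b -> maximal_run (interleaved a b) p q ->
  carries_clasp D rho (eye a) (eye b) p q <-> ~~ mixed p (+) mixed q.
Proof.
move=> ab h.
have mep : meets a b p.
  have := maximal_run_start h; rewrite (interleaved_next p ab).
  by case: (interleaved a b p).
have meq : meets a b q.
  have := maximal_run_end h; rewrite (interleaved_next q ab).
  by case: (interleaved a b q) => //; case: (meets a b q).
have [[s hs] us] := cross_with_typeP mep.
have [[t ht] ut] := cross_with_typeP meq.
split.
  case=> s' [t' [/us hs' /ut ht' e]].
  have : mixed p <-> mixed q by rewrite -hs' -ht'.
  by case: (mixed p); case: (mixed q) => //= -[h1 h2];
    [have := h1 isT | have := h2 isT].
move=> e; exists s, t; split=> //; rewrite (us _ hs) (ut _ ht).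
by move: e; case: (mixed p); case: (mixed q).
Qed.

Lemma carries_clasp_sym E F p q :
  carries_clasp D rho E F p q -> carries_clasp D rho F E p q.
Proof.
have sym i t : cross_with_type D rho E F i t -> cross_with_type D rho F E i t.
  case=> k [l [u [l' [u' [h1 h2 h3 h4 h5]]]]].
  exists k, l', u', l, u; split=> //.
  by case: t h5; rewrite /same_pair; lia.
by case=> s [t [/sym h1 /sym h2 h3]]; exists s, t.
Qed.

Lemma non_nested_intervalE a b p q :
  non_nested_interval (eye a) (eye b) p q <-> maximal_run (interleaved a b) p q.
Proof.
split=> -[pq h1 h2 h3]; split=> //.
- by move=> i /h1 ?; apply/asboolP.
- by move/asboolP.
- by move/asboolP.
- by move=> i /h1 /asboolP.
- by move=> h; apply: h2; apply/asboolP.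
- by move=> h; apply: h3; apply/asboolP.
Qed.

Lemma eye_inj a b i : present a i -> eye a = eye b -> a = b.
Proof.
case=> j jn <- e; have : eye (label i j) (i, j) by [].
by rewrite e => -[].
Qed.

Local Notation N := (size D).
Local Notation quad := (('I_N * 'I_N) * ('I_N * 'I_N))%type.

(** The unordered pair of eyes of a clasp is coded by their labels in increasing
    order. *)
Definition clasp_code (t : quad) : bool :=
  [&& t.1.1 < t.1.2, `[< maximal_run (interleaved t.1.1 t.1.2) t.2.1 t.2.2 >] &
      ~~ mixed t.2.1 (+) mixed t.2.2].

Definition decode (t : quad) : set (set segment) * (nat * nat) :=
  ([set eye t.1.1; eye t.1.2], (t.2.1 : nat, t.2.2 : nat)).

Lemma claspsE : clasps D rho = decode @` [set t | clasp_code t].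
Proof.
apply/seteqP; split=> [[S [p q]]|_ [t ht <-]].
- have main a b : a < b -> maximal_run (interleaved a b) p q ->
    carries_clasp D rho (eye a) (eye b) p q ->
    (decode @` [set t | clasp_code t]) ([set eye a; eye b], (p, q)).
    move=> ab h hc; have ab' : a != b by lia.
    have [[j jn lj] [j' jn' lj']] : present a q /\ present b q.
      by apply: interleaved_present; case/andP: (maximal_run_end h).
    have qN := nstrands_lt jn; have aq := label_lt jn; have bq := label_lt jn'.
    have pq : p < q by case: h.
    have aN : a < N by lia.
    have bN : b < N by lia.
    have pN : p < N by lia.
    exists ((Ordinal aN, Ordinal bN), (Ordinal pN, Ordinal qN)) => //.
    apply/and3P; split=> //=; first exact/asboolP.
    exact: (iffLR (carries_claspE ab' h)) hc.
  case=> E [F [/componentP[a _ ->] /componentP[b _ ->] EF /= ->]].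
  case=> /non_nested_intervalE h hc.
  case: (ltngtP a b) => ab; last by case: EF; rewrite ab.
    exact: main.
  rewrite setUC; apply: main => //; last exact: carries_clasp_sym.
  case: h => pq h1 h2 h3; split=> //.
  + by move=> i /h1; rewrite interleaved_sym.
  + by rewrite interleaved_sym.
  + by rewrite interleaved_sym.
- case: t ht => [[a b] [p q]] /and3P[/= ab /asboolP h hc].
  have ab' : (a : nat) != b by lia.
  have [[j jn lj] [j' jn' lj']] : present a q /\ present b q.
    by apply: interleaved_present; case/andP: (maximal_run_end h).
  exists (eye a), (eye b); split=> //.
  + by rewrite -lj; apply: component_strand.
  + by rewrite -lj'; apply: component_strand.
  + have pa : present a q by exists j.
    by move/(eye_inj pa); lia.
  + split; first exact/non_nested_intervalE.
    exact: (iffRL (carries_claspE ab' h)) hc.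
Qed.

Lemma decode_inj : {in [set t | clasp_code t] &, injective decode}.
Proof.
move=> [[a b] [p q]] [[a' b'] [p' q']]; rewrite !inE.
move=> /and3P[/= ab /asboolP h _] /and3P[/= ab' /asboolP h' _] [e ep eq].
have ep' : p = p' by apply: val_inj.
have eq' : q = q' by apply: val_inj.
have [pa pb] : present a q /\ present b q.
  by apply: interleaved_present; case/andP: (maximal_run_end h).
have ea : [set eye a'; eye b'] (eye a) by rewrite -e; left.
have eb : [set eye a'; eye b'] (eye b) by rewrite -e; right.
have [xa xb] : a = a' :> nat /\ b = b' :> nat.
  by case: ea => /(eye_inj pa) ea; case: eb => /(eye_inj pb) eb; lia.
by rewrite ep' eq' (val_inj xa) (val_inj xb).
Qed.

Lemma clasps_card : clasps D rho #= `I_(#|clasp_code|).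
Proof.
rewrite claspsE; apply: card_eq_trans (inj_card_eq decode_inj) _.
have -> : [set t | clasp_code t] =
    (@enum_val _ clasp_code) @` [set: 'I_#|clasp_code|].
  apply/seteqP; split=> [t ht|_ [i _ <-]]; last exact: (enum_valP i).
  exists (enum_rank_in (ht : t \in clasp_code) t) => //.
  by rewrite enum_rankK_in.
apply: card_eq_trans (inj_card_eq (in2W (@enum_val_inj _ _))) _.
by rewrite card_eq_sym; exact: card_II.
Qed.

(** Summing over the intervals of one pair of eyes leaves its crossings, with the
    weights given by [meets_weight]; each unresolved crossing then comes from
    exactly one pair of eyes. *)
Lemma parity_clasps :
  odd #|clasp_code| = \big[addb/false]_(i < N) run_weight D rho id i.
Proof.
rewrite odd_card /clasp_code.
rewrite -(pair_bigA _ (fun (ab pq : 'I_N * 'I_N) =>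
  [&& ab.1 < ab.2, `[< maximal_run (interleaved ab.1 ab.2) pq.1 pq.2 >] &
      ~~ mixed pq.1 (+) mixed pq.2])) /=.
have start0 a b : ~~ interleaved a b 0.
  by apply/negP => /interleaved_present[[j]]; rewrite /nstrands take0.
have end0 a b : ~~ interleaved a b N.
  by apply/negP => /interleaved_present[[j]]; rewrite nstrands_size.
have inner (ab : 'I_N * 'I_N) :
  \big[addb/false]_(pq : 'I_N * 'I_N)
    [&& ab.1 < ab.2, `[< maximal_run (interleaved ab.1 ab.2) pq.1 pq.2 >] &
      ~~ mixed pq.1 (+) mixed pq.2] =
  \big[addb/false]_(i < N)
    [&& ab.1 < ab.2, meets ab.1 ab.2 i & run_weight D rho id i].
  have [lt|ge] /= := ltnP ab.1 ab.2; last by rewrite !big1.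
  rewrite (parity_runs (fun i => ~~ mixed i) mixed (start0 _ _) (end0 _ _)).
  apply: eq_bigr => i _; have ne : (ab.1 : nat) != ab.2 by lia.
  rewrite interleaved_next //; case: (boolP (meets _ _ _)) => /= me.
    by rewrite -(meets_weight ne me);
      case: (interleaved _ _ _); case: (mixed _).
  by case: (interleaved _ _ _); case: (mixed _).
rewrite (eq_bigr _ (fun ab _ => inner ab)) exchange_big /=.
apply: eq_bigr => i _.
case wi: (run_weight D rho id i); last first.
  by rewrite big1 // => ab _; rewrite !andbF.
move: wi; rewrite /run_weight; case De: (onth D i) => [[[] k]|] //= w.
have ri : ~~ rho i by move: w; rewrite /weight /= => /andP[].
have /= kn := nstrands_fit De.
have k0 : k < n i by lia.
have k1 : k.+1 < n i by lia.
have iN := nstrands_lt k0.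
have l0 := label_lt k0; have l1 := label_lt k1.
have ne : label i k != label i k.+1.
  rewrite label_eq // negb_or [_ == P i k]eq_sym.
  by have := runD De; rewrite /admits /= (negbTE ri) => ->; rewrite andbT; lia.
have aN : minn (label i k) (label i k.+1) < N by lia.
have bN : maxn (label i k) (label i k.+1) < N by lia.
rewrite (@big_addb_unique _ _ (Ordinal aN, Ordinal bN)) /meets De /= ri /=.
  by rewrite andbT; lia.
move=> [a b] /=; rewrite andbT => h.
by congr (_, _); apply: val_inj => /=; lia.
Qed.
End Eyes.

Theorem corollary10 (R : realType) (K : legendrian_link R) :
  has_decomposable_filling K -> has_even_normal_ruling K.
Proof.
move=> [D KD filling].
have [rho [subD runD wt]] := reach_run (reach_filling filling).
have fD : front D.
  by elim: filling => [x y []|x y z _ _ _] //.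
exists D, rho; split=> //; first exact: run_normal_ruling.
exists #|@clasp_code D rho|; first exact: clasps_card.
by rewrite (parity_clasps fD runD) wt.
Qed.
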